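(* Let $t\in\Delta^+$ be an injective-reachable quantum seed, $k\in I_{uf}$, $d\in\mathbb N$, and $t'=\mu_kt$. (1) Let $g=d\cdot\deg^t\mu_k^*X_k(t')$ and let $Z\in\mathcal{LP}(t)\cap\mu^*_{t[-1],t}\mathcal{LP}(t[-1])$ be $g$-pointed. If $Z$ is compatibly pointed at $t,t[-1]$, then $Z=\mu_k^*X_k(t')^d$. (2) Let $g=d\cdot\deg^t\mu_k^*I_k(t')$ and let $Z\in\mathcal{LP}(t)\cap\mu^*_{t[1],t}\mathcal{LP}(t[1])$ be $g$-pointed. If $Z$ is compatibly pointed at $t[1],t$, then $Z=\mu_k^*I_k(t')^d$.
   Context: **Quantum seeds.** $\Bbbk=\mathbb Z[q^{\pm1/2}]$, $v=q^{1/2}$, $[x]_+=\max(x,0)$ (componentwise for vectors), $\mathbb N=\{0,1,\dots\}$. $I=I_{uf}\sqcup I_f$ is a finite set (unfrozen/frozen vertices). A quantum seed $t$ consists of an integer matrix $\tilde B(t)=(b_{ij})_{i\in I,j\in I_{uf}}$ of full rank $|I_{uf}|$ whose square part $B(t)=(b_{ij})_{i,j\in I_{uf}}$ is skew-symmetrizable, a skew-symmetric integer matrix $\Lambda(t)=(\Lambda_{ij})_{i,j\in I}$ with $\tilde B(t)^T\Lambda(t)=(D'\ 0)$, $D'=\mathrm{diag}(d'_k)_{k\in I_{uf}}$, $d'_k\in\mathbb Z_{>0}$, and variables $X_i(t)$, $i\in I$. $M^\circ(t)=\bigoplus_{i\in I}\mathbb Zf_i\cong\mathbb Z^I$ carries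 $\lambda(f_i,f_j)=\Lambda_{ij}$. $\mathcal{LP}(t)=\bigoplus_{m\in M^\circ(t)}\Bbbk X(t)^m$ has commutative product $X^m\cdot X^{m'}=X^{m+m'}$ and twisted product $X^m*X^{m'}=v^{\lambda(m,m')}X^{m+m'}$; $X_i(t)=X(t)^{f_i}$; as an algebra it is taken with $*$ (powers are with respect to $*$), and $\mathcal F(t)$ is its skew-field of fractions. $Y(t)^n=X(t)^{\tilde B(t)n}$ for $n\in\mathbb Z^{I_{uf}}$. For $k\in I_{uf}$, $t'=\mu_kt$ has $b'_{ij}=-b_{ij}$ if $k\in\{i,j\}$, otherwise $b'_{ij}=b_{ij}+b_{ik}[b_{kj}]_++[-b_{ik}]_+b_{kj}$; $\Lambda(t')_{ij}=\lambda(f'_i,f'_j)$ with $f'_i=f_i$ ($i\ne k$), $f'_k=-f_k+\sum_j[-b_{jk}]_+f_j$; and $\mu_k^*:\mathcal F(t')\cong\mathcal F(t)$ sends $X_i(t')\mapsto X_i(t)$ ($i\ne k$), $X_k(t')\mapsto X(t)^{-f_k+\sum_j[-b_{jk}]_+f_j}+X(t)^{-f_k+\sum_j[b_{jk}]_+f_j}$. $\Delta^+$ is the set of seeds obtained from an initial seed by iterated mutations. A mutation sequence $\overleftarrow\mu$ with $t_2=\overleftarrow\mu t_1$ induces the composite $\overleftarrow\mu^*:\mathcal F(t_2)\cong\mathcal F(t_1)$, which depends only on $t_1,t_2$ and is also written $\mu^*_{t_2,t_1}$. **Degrees.** $m'\preceq_tm$ in $M^\circ(t)$ iff $m'=m+\tilde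 B(t)n$ for some $n\in\mathbb N^{I_{uf}}$. $\deg^tZ$ is the unique $\prec_t$-maximal Laurent degree of $Z$, if it exists. An element is $g$-pointed if it has the form $X(t)^g\cdot(1+\sum_{0\ne n\in\mathbb N^{I_{uf}}}c_nY(t)^n)$, $c_n\in\Bbbk$. All cluster variables, expanded in $\mathcal{LP}(t)$, are pointed. **Compatibly pointed.** For $t'=\mu_kt$, $\phi_{t',t}:M^\circ(t)\to M^\circ(t')$, $g\mapsto g'$, is $g'_k=-g_k$, $g'_i=g_i+[b_{ik}]_+g_k$ if $i\neq k,g_k\ge0$, $g'_i=g_i+[-b_{ik}]_+g_k$ if $i\ne k,g_k<0$; for general $t'\in\Delta^+$, $\phi_{t',t}$ is the composite along a mutation sequence from $t$ to $t'$ (independent of the choice). $Z\in\mathcal{LP}(t)\cap\mu^*_{t',t}\mathcal{LP}(t')$ is compatibly pointed at $t,t'$ if $Z$ is $g$-pointed for some $g\in M^\circ(t)$ and $\mu^*_{t,t'}Z\in\mathcal{LP}(t')$ is $\phi_{t',t}(g)$-pointed. **Injective-reachability.** $t$ is injective-reachable if there are $t[1]=\overleftarrow\mu t\in\Delta^+$ and a permutation $\sigma$ of $I_{uf}$ such that for each $k\in I_{uf}$ the $I_{uf}$-part of the degree of $I_k(t):=\overleftarrow\mu^*X_{\sigma k}(t[1])\in\mathcal{LP}(t)$ is $-f_k$. The property then holds for all seeds of $\Delta^+$, $(\mu_kt)[1]=\mu_{\sigma k}(t[1])$ with the same $\sigma$, and $t[-1]$ denotes the seed with $t[-1][1]=t$.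 *)

(* Defs.v *)
From HB Require Import structures.
From mathcomp Require Import all_boot all_order all_algebra all_fingroup.
From mathcomp Require Import finmap.
From mathcomp Require Import monalg.
From mathcomp Require Import ring lra zify.

Set Implicit Arguments.
Unset Strict Implicit.
Unset Printing Implicit Defensive.

Import Order.TTheory GRing.Theory Num.Theory.

Local Open Scope ring_scope.

Record bicharacter (R : comNzRingType) (M : zmodType) := Bicharacter {
  bichar :> M -> M -> R;
  bichar0l : forall m, bichar 0 m = 1;
  bichar0r : forall m, bichar m 0 = 1;
  bicharDl : forall a b c, bichar (a + b) c = bichar a c * bichar b c;
  bicharDr : forall a b c, bichar a (b + c) = bichar a b * bichar a c
}.

Section TwistedGroupAlgebra.
Variables (R : comNzRingType) (M : zmodType).

Definition tmul (chi : M -> M -> R) (x y : {malg R[M]}) : {malg R[M]} :=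
  \sum_(a <- msupp x) \sum_(b <- msupp y) << chi a b * (x@_a * y@_b) *g a + b >>.

Definition trivial_bichar : bicharacter R M.
Proof.
by exists (fun _ _ => 1) => *; rewrite ?mulr1.
Defined.

(* The group algebra of M over R with X^a * X^b = chi(a, b) X^(a + b). *)
Definition twisted_algebra (chi : bicharacter R M) : Type := {malg R[M]}.

Variable chi : bicharacter R M.
Implicit Types x y z : {malg R[M]}.

HB.instance Definition _ := GRing.Lmodule.copy (twisted_algebra chi) {malg R[M]}.

Local Notation mul := (tmul chi).

Lemma tmulw (d1 d2 : {fset M}) x y : (msupp x `<=` d1)%fset -> (msupp y `<=` d2)%fset ->
  mul x y = \sum_(a <- d1) \sum_(b <- d2) << chi a b * (x@_a * y@_b) *g a + b >>.
Proof.
move=> le1 le2; rewrite /mul /tmul (big_fset_incl _ le1) /=.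
  apply/eq_bigr=> a _; apply/big_fset_incl => // b _ /mcoeff_outdom ->.
  by rewrite !mulr0 monalgU0.
move=> a _ /mcoeff_outdom xa.
by rewrite big1 // => b _; rewrite xa mul0r mulr0 monalgU0.
Qed.

Let tmul0g : left_zero 0 mul.
Proof. by move=> x; rewrite /mul /tmul msupp0 big_seq_fset0. Qed.

Let tmulg0 : right_zero 0 mul.
Proof.
by move=> x; rewrite /mul /tmul msupp0 big1 // => a _; rewrite big_seq_fset0.
Qed.

Lemma tmulUU c1 c2 a b :
  mul << c1 *g a >> << c2 *g b >> = << chi a b * (c1 * c2) *g a + b >>.
Proof. by rewrite (tmulw msuppU_le msuppU_le) !big_seq_fset1 !mcoeffUU. Qed.

Let tmulDl : left_distributive mul +%R.
Proof.
move=> x y z.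
rewrite (tmulw (msuppD_le x y) (fsubset_refl (msupp z))).
rewrite (tmulw (fsubsetUl (msupp x) (msupp y)) (fsubset_refl (msupp z))).
rewrite (tmulw (fsubsetUr (msupp x) (msupp y)) (fsubset_refl (msupp z))).
rewrite -big_split /=; apply/eq_bigr=> a _.
rewrite -big_split /=; apply/eq_bigr=> b _.
by rewrite mcoeffD mulrDl mulrDr monalgUD.
Qed.

Let tmulDr : right_distributive mul +%R.
Proof.
move=> x y z.
rewrite (tmulw (fsubset_refl (msupp x)) (msuppD_le y z)).
rewrite (tmulw (fsubset_refl (msupp x)) (fsubsetUl (msupp y) (msupp z))).
rewrite (tmulw (fsubset_refl (msupp x)) (fsubsetUr (msupp y) (msupp z))).
rewrite -big_split /=; apply/eq_bigr=> a _.
rewrite -big_split /=; apply/eq_bigr=> b _.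
by rewrite mcoeffD mulrDr mulrDr monalgUD.
Qed.

Let tmulsuml I (r : seq I) (f : I -> {malg R[M]}) y :
  mul (\sum_(i <- r) f i) y = \sum_(i <- r) mul (f i) y.
Proof. exact: (big_morph (mul^~ y) (fun _ _ => tmulDl _ _ _) (tmul0g _)). Qed.

Let tmulsumr I (r : seq I) (f : I -> {malg R[M]}) y :
  mul y (\sum_(i <- r) f i) = \sum_(i <- r) mul y (f i).
Proof. exact: (big_morph (mul y) (fun _ _ => tmulDr _ _ _) (tmulg0 _)). Qed.

Let tmul1g : left_id << 0 >> mul.
Proof.
move=> x; rewrite {1}[x]monalgE tmulsumr [RHS]monalgE.
by apply/eq_bigr => a _; rewrite tmulUU bichar0l !mul1r add0r.
Qed.

Let tmulg1 : right_id << 0 >> mul.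
Proof.
move=> x; rewrite {1}[x]monalgE tmulsuml [RHS]monalgE.
by apply/eq_bigr => a _; rewrite tmulUU bichar0r mulr1 mul1r addr0.
Qed.

Let tmulA : associative mul.
Proof.
move=> x y z; pose U (w : {malg R[M]}) a := << w@_a *g a >> : {malg R[M]}.
transitivity (\sum_(a <- msupp x) \sum_(b <- msupp y) \sum_(c <- msupp z)
    mul (U x a) (mul (U y b) (U z c))).
  rewrite [x in LHS]monalgE tmulsuml; apply/eq_bigr => a _.
  rewrite [y in LHS]monalgE tmulsuml tmulsumr; apply/eq_bigr => b _.
  by rewrite [z in LHS]monalgE !tmulsumr.
rewrite [x in RHS]monalgE !tmulsuml; apply/eq_bigr => a _.
rewrite [y in RHS]monalgE tmulsumr tmulsuml; apply/eq_bigr => b _.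
rewrite [z in RHS]monalgE tmulsumr; apply/eq_bigr => c _.
rewrite !tmulUU bicharDr bicharDl addrA.
by congr << _ *g _ >>; ring.
Qed.

Let tone_neq0 : (<< 0 >> : {malg R[M]}) != 0.
Proof. by rewrite monalgU_eq0 oner_eq0. Qed.

HB.instance Definition _ :=
  GRing.Zmodule_isNzRing.Build (twisted_algebra chi)
    tmulA tmul1g tmulg1 tmulDl tmulDr tone_neq0.

Let tscaleAl (c : R) (x y : twisted_algebra chi) : c *: (x * y) = (c *: x) * y.
Proof.
rewrite -[LHS]/(c *: mul x y) -[RHS]/(mul (c *: x) y).
rewrite (tmulw (msuppZ_le c x) (fsubset_refl _)) /tmul scaler_sumr.
apply/eq_bigr => a _; rewrite scaler_sumr; apply/eq_bigr => b _.
apply/malgP => k; rewrite mcoeffZ !mcoeffU mcoeffZ.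
by rewrite mulrnAr -mulrA mulrCA.
Qed.

Let tscaleAr (c : R) (x y : twisted_algebra chi) : c *: (x * y) = x * (c *: y).
Proof.
rewrite -[LHS]/(c *: mul x y) -[RHS]/(mul x (c *: y)).
rewrite (tmulw (fsubset_refl _) (msuppZ_le c y)) /tmul scaler_sumr.
apply/eq_bigr => a _; rewrite scaler_sumr; apply/eq_bigr => b _.
apply/malgP => k; rewrite mcoeffZ !mcoeffU mcoeffZ.
by rewrite mulrnAr mulrCA [in RHS](mulrCA _ c).
Qed.

HB.instance Definition _ :=
  GRing.Lmodule_isLalgebra.Build R (twisted_algebra chi) tscaleAl.
HB.instance Definition _ :=
  GRing.Lalgebra_isAlgebra.Build R (twisted_algebra chi) tscaleAr.

End TwistedGroupAlgebra.

(* Z[q^(1/2), q^(-1/2)]; the monomial << z >> is v^z, where v = q^(1/2). *)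
Definition qring : Type := twisted_algebra (trivial_bichar int int).

HB.instance Definition _ := GRing.NzRing.on qring.

Lemma qring_mulC : commutative (@GRing.mul qring).
Proof.
move=> x y; rewrite -[LHS]/(tmul (trivial_bichar int int) x y).
rewrite -[RHS]/(tmul (trivial_bichar int int) y x) /tmul exchange_big /=.
apply/eq_bigr => a _; apply/eq_bigr => b _.
by rewrite addrC [x@_b * _]mulrC.
Qed.

HB.instance Definition _ :=
  GRing.PzRing_hasCommutativeMul.Build qring qring_mulC.

Definition vpow (z : int) : qring := << z >>.

Lemma vpow0 : vpow 0 = 1. Proof. by []. Qed.

Lemma vpowD a b : vpow (a + b) = vpow a * vpow b.
Proof.
rewrite -[RHS]/(tmul (trivial_bichar int int) (vpow a) (vpow b)).
by rewrite tmulUU !mulr1.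
Qed.

Section Seeds.
Variables (n m : nat).

(* The vertices are 'I_(n + m); the first n of them, the image of lshift m,
   are the unfrozen ones. Columns of the exchange matrix are indexed by 'I_n. *)
Local Notation vertex := ('I_(n + m)).
Local Notation uf := (@lshift n m).
Local Notation lattice := ('cV[int]_(n + m)).

Definition pos (x : int) : int := Num.max x 0.

Definition bas (i : vertex) : lattice := delta_mx i 0.

Definition skew_symmetrizable (B : 'M[int]_n) : Prop :=
  exists d : 'I_n -> int,
    (forall i, 0 < d i) /\ forall i j, d i * B i j = - (d j * B j i).

Definition compatible (B : 'M[int]_(n + m, n)) (L : 'M[int]_(n + m)) : Prop :=
  exists d : 'rV[int]_n,
    (forall i, 0 < d 0 i) /\ B^T *m L = row_mx (diag_mx d) (0 : 'M_(n, m)).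

Definition form (L : 'M[int]_(n + m)) (x y : lattice) : int :=
  (x^T *m L *m y) 0 0.

Definition mut_bas (B : 'M[int]_(n + m, n)) (k : 'I_n) (i : vertex) : lattice :=
  if i == uf k then - bas (uf k) + \sum_j pos (- B j k) *: bas j else bas i.

Definition mutB (B : 'M[int]_(n + m, n)) (k : 'I_n) : 'M[int]_(n + m, n) :=
  \matrix_(i, j)
    if (i == uf k) || (j == k) then - B i j
    else B i j + B i k * pos (B (uf k) j) + pos (- B i k) * B (uf k) j.

Definition mutL (B : 'M[int]_(n + m, n)) (L : 'M[int]_(n + m)) (k : 'I_n) :
    'M[int]_(n + m) :=
  \matrix_(i, j) form L (mut_bas B k i) (mut_bas B k j).

Record qseed := QSeed {
  Bt : 'M[int]_(n + m, n);
  La : 'M[int]_(n + m);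
  Bt_full_rank : \rank (map_mx (intr : int -> rat) Bt) = n;
  Bt_skew : skew_symmetrizable (usubmx Bt);
  La_skew : La^T = - La;
  Bt_La_compatible : compatible Bt La
}.

Lemma pos_scale c x : 0 < c -> c * pos x = pos (c * x).
Proof. by move=> c0; rewrite /pos maxr_pMr ?mulr0 // ltW. Qed.

Section Mutation.
Variables (B : 'M[int]_(n + m, n)) (k : 'I_n).
Hypothesis skB : skew_symmetrizable (usubmx B).

Let Bkk : B (uf k) k = 0.
Proof.
have [d [d0 dB]] := skB; move: (dB k k) (d0 k); rewrite !mxE; nia.
Qed.

Let r : 'rV[int]_(n + m) := delta_mx 0 (uf k).
Let u : lattice := \col_i (pos (- B i k) - 2 * (i == uf k)%:R).
Let e : 'cV[int]_n := delta_mx k 0.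
Let w : 'rV[int]_n := \row_j (pos (B (uf k) j) - 2 * (j == k)%:R).
Let E : 'M[int]_(n + m) := 1%:M + u *m r.
Let F : 'M[int]_n := 1%:M + e *m w.

Let ru : r *m u = (- 2)%:M.
Proof.
apply/matrixP => i j; rewrite -rowE !mxE !ord1 !eqxx Bkk oppr0 /pos; lia.
Qed.

Let we : w *m e = (- 2)%:M.
Proof.
apply/matrixP => i j; rewrite -colE !mxE !ord1 !eqxx Bkk /pos; lia.
Qed.

Let EE : E *m E = 1%:M.
Proof.
rewrite /E mulmxDl !mulmxDr !mul1mx !mulmx1 mulmxA -(mulmxA u) ru.
rewrite mul_mx_scalar -scalemxAl -addrA -[RHS]addr0; congr (_ + _).
by apply/matrixP => i j; rewrite !mxE; ring.
Qed.

Let FF : F *m F = 1%:M.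
Proof.
rewrite /F mulmxDl !mulmxDr !mul1mx !mulmx1 mulmxA -(mulmxA e) we.
rewrite mul_mx_scalar -scalemxAl -addrA -[RHS]addr0; congr (_ + _).
by apply/matrixP => i j; rewrite !mxE; ring.
Qed.

Let mutBE : mutB B k = E *m B *m F.
Proof.
have rBe : r *m B *m e = 0.
  by apply/matrixP => i j; rewrite -rowE -colE !mxE Bkk.
have -> : E *m B *m F = B + u *m (r *m B) + (B *m e) *m w.
  rewrite /E /F mulmxDl mul1mx mulmxDr mulmx1 mulmxA; congr (_ + _).
    by rewrite mulmxA.
  by rewrite mulmxDl -(mulmxA u) -(mulmxA u) rBe mulmx0 addr0.
apply/matrixP => i j; rewrite -rowE -colE !mxE !big_ord1 !mxE.
case: (eqVneq i (uf k)) => [->|ik] /=.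
  by rewrite Bkk oppr0 mul0r /pos maxxx; ring.
case: (eqVneq j k) => [->|jk] /=.
  by rewrite Bkk /pos maxxx; ring.
by ring.
Qed.

Let mut_basE i : mut_bas B k i = col i E.
Proof.
have su : \sum_j pos (- B j k) *: bas j = \col_j pos (- B j k).
  apply/matrixP => a b; rewrite summxE (bigD1 a) //= big1 => [|c ca].
    by rewrite !mxE ord1 !eqxx mulr1 addr0.
  by rewrite !mxE eq_sym (negbTE ca) mulr0.
rewrite /mut_bas su; apply/matrixP => a b; rewrite !mxE big_ord1 !mxE !ord1 !eqxx.
case: (eqVneq i (uf k)) => [->|ik]; rewrite !mxE /= ?eqxx ?andbT.
  by lia.
by rewrite mulr0 addr0.
Qed.

Let mutLE L : mutL B L k = E^T *m L *m E.
Proof.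
apply/matrixP => i j; rewrite mxE /form !mut_basE !colE trmx_mul trmx_delta.
by rewrite -!mulmxA -rowE !mulmxA -colE [LHS]mxE mxE.
Qed.

Lemma mutB_full_rank :
  \rank (map_mx (intr : int -> rat) B) = n ->
  \rank (map_mx (intr : int -> rat) (mutB B k)) = n.
Proof.
move=> rB; rewrite mutBE !map_mxM /=.
set E' := map_mx _ E; set F' := map_mx _ F.
have E1 : E' *m E' = 1%:M by rewrite -map_mxM EE map_mx1.
have F1 : F' *m F' = 1%:M by rewrite -map_mxM FF map_mx1.
have [uE _] := mulmx1_unit E1; have [uF _] := mulmx1_unit F1.
rewrite mxrankMfree ?row_free_unit // -mxrank_tr trmx_mul mxrankMfree ?mxrank_tr //.
by rewrite row_free_unit unitmx_tr.
Qed.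

Lemma mutB_skew : skew_symmetrizable (usubmx (mutB B k)).
Proof.
have [d [d0 dB]] := skB; exists d; split=> // i j.
have {}dB a b : d a * B (uf a) b = - (d b * B (uf b) a).
  by have := dB a b; rewrite !mxE.
rewrite !mxE !(inj_eq (@lshift_inj _ _)) orbC.
case: ifP => [ijk|nijk]; first by rewrite !mulrN dB.
have p1 a b : d a * pos (- B (uf a) b) = d b * pos (B (uf b) a).
  by rewrite !pos_scale // mulrN dB opprK.
rewrite !mulrDr !mulrA (p1 i) (p1 j) (dB i j) (dB i k) (dB j k) !mulNr; ring.
Qed.

Lemma mutL_skew L : L^T = - L -> (mutL B L k)^T = - mutL B L k.
Proof.
by move=> sL; rewrite mutLE !trmx_mul trmxK sL mulNmx mulmxN mulmxA.
Qed.

Lemma mut_compatible L :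
  L^T = - L -> compatible B L -> compatible (mutB B k) (mutL B L k).
Proof.
move=> sL [d [d0 BL]]; exists d; split => //.
have dB i j : d 0 i * B (uf i) j = - (d 0 j * B (uf j) i).
  have H : (B^T *m L *m B)^T = - (B^T *m L *m B).
    by rewrite !trmx_mul trmxK sL mulNmx mulmxN mulmxA.
  have HE a b : (B^T *m L *m B) a b = d 0 a * B (uf a) b.
    by rewrite BL -{1}[B]vsubmxK mul_row_col mul0mx addr0 mul_diag_mx !mxE.
  by move/matrixP: H => /(_ j i); rewrite [X in X = _]mxE [X in _ = X]mxE !HE.
have p1 a b : d 0 a * pos (- B (uf a) b) = d 0 b * pos (B (uf b) a).
  by rewrite !pos_scale // mulrN dB opprK.
set D := row_mx _ _ in BL *.
have ET : E^T *m E^T = 1%:M by rewrite -trmx_mul EE trmx1.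
have FT : F^T *m F^T = 1%:M by rewrite -trmx_mul FF trmx1.
have DE : D *m E = F^T *m D.
  rewrite /E /F [(1%:M + _)^T]linearD /= trmx1 mulmxDr mulmxDl mulmx1 mul1mx; congr (_ + _).
  have Du : D *m u = \col_i (d 0 i * u (uf i) 0).
    rewrite -[u]vsubmxK /D mul_row_col mul0mx addr0 mul_diag_mx vsubmxK.
    by apply/matrixP => i j; rewrite !mxE.
  rewrite mulmxA Du trmx_mul /e trmx_delta -(mulmxA w^T) -rowE.
  apply/matrixP => i j; rewrite !mxE !big_ord1 !mxE /= (inj_eq (@lshift_inj _ _)).
  case: split_ordP => j' ->; rewrite ?mxE; last first.
    by rewrite eq_rlshift /= mulr0 mulr0.
  rewrite (inj_eq (@lshift_inj _ _)) mulrBr p1.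
  case: (eqVneq j' k) => [_|jk]; last by rewrite /= mulr0n !mulr0.
  by rewrite mulr1n; case: (eqVneq i k) => [->|ik] /=; ring.
rewrite mutBE mutLE !trmx_mul !mulmxA -(mulmxA _ E^T E^T) ET mulmx1.
by rewrite -(mulmxA F^T) BL -mulmxA DE mulmxA FT mul1mx.
Qed.

End Mutation.

Definition mu (t : qseed) (k : 'I_n) : qseed :=
  QSeed (mutB_full_rank k (Bt_skew t) (Bt_full_rank t))
        (mutB_skew k (Bt_skew t))
        (mutL_skew k (Bt_skew t) (La_skew t))
        (mut_compatible k (Bt_skew t) (La_skew t) (Bt_La_compatible t)).

(* Mutations are performed from the head of the word to its tail. *)
Fixpoint mutseq (t : qseed) (w : seq 'I_n) : qseed :=
  if w is k :: w' then mutseq (mu t k) w' else t.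

Definition in_Delta (t0 t : qseed) : Prop := exists w, t = mutseq t0 w.

Lemma form0l L x : form L 0 x = 0.
Proof. by rewrite /form trmx0 !mul0mx mxE. Qed.

Lemma form0r L x : form L x 0 = 0.
Proof. by rewrite /form mulmx0 mxE. Qed.

Lemma formDl L x y z : form L (x + y) z = form L x z + form L y z.
Proof. by rewrite /form linearD /= !mulmxDl mxE. Qed.

Lemma formDr L x y z : form L x (y + z) = form L x y + form L x z.
Proof. by rewrite /form mulmxDr mxE. Qed.

Definition torus_bichar (t : qseed) : bicharacter qring lattice.
Proof.
exists (fun a b => vpow (form (La t) a b)) => *.
- by rewrite form0l.
- by rewrite form0r.
- by rewrite formDl vpowD.
- by rewrite formDr vpowD.
Defined.

(* The ring product of LP t is the twisted one. *)
Definition LP (t : qseed) : Type := twisted_algebra (torus_bichar t).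

HB.instance Definition _ t := GRing.Algebra.on (LP t).

Definition cmul (t : qseed) (x y : LP t) : LP t :=
  tmul (trivial_bichar qring lattice) x y.

Definition Xmon (t : qseed) (g : lattice) : LP t := << g >>.

Lemma XmonM t (g h : lattice) :
  Xmon t g * Xmon t h = vpow (form (La t) g h) *: Xmon t (g + h).
Proof.
rewrite -[LHS]/(tmul (torus_bichar t) (Xmon t g) (Xmon t h)) tmulUU !mulr1 /=.
by apply/malgP => a; rewrite mcoeffZ !mcoeffU mulrnAr mulr1.
Qed.

Lemma cmulXmon t (g h : lattice) : cmul (Xmon t g) (Xmon t h) = Xmon t (g + h).
Proof. by rewrite /cmul tmulUU !mulr1. Qed.

Definition Ymon (t : qseed) (a : 'cV[int]_n) : LP t := Xmon t (Bt t *m a).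

Definition natvec (a : 'cV[nat]_n) : 'cV[int]_n := map_mx Posz a.

Definition preceq (t : qseed) (g' g : lattice) : Prop :=
  exists a : 'cV[nat]_n, g' = g + Bt t *m natvec a.

Definition prec (t : qseed) (g' g : lattice) : Prop := preceq t g' g /\ g' <> g.

Definition LP_maximal (t : qseed) (z : LP t) (g : lattice) : Prop :=
  z@_g <> 0 /\ forall g', z@_g' <> 0 -> ~ prec t g g'.

Definition LP_degree (t : qseed) (z : LP t) (g : lattice) : Prop :=
  forall g', LP_maximal z g' <-> g' = g.

Definition LP_pointed (t : qseed) (g : lattice) (z : LP t) : Prop :=
  exists (s : {fset 'cV[nat]_n}) (c : 'cV[nat]_n -> qring),
    0 \notin s /\
    z = cmul (Xmon t g) (1 + \sum_(a <- s) c a *: Ymon t (natvec a)).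

(* The map M(t) -> M(mu t k) on degrees. *)
Definition phi (t : qseed) (k : 'I_n) (g : lattice) : lattice :=
  \col_i
    if i == uf k then - g (uf k) 0
    else if 0 <= g (uf k) 0 then g i 0 + pos (Bt t i k) * g (uf k) 0
    else g i 0 + pos (- Bt t i k) * g (uf k) 0.

(* M(t) -> M(mutseq t w), along w. *)
Fixpoint phi_seq (t : qseed) (w : seq 'I_n) (g : lattice) : lattice :=
  if w is k :: w' then phi_seq (mu t k) w' (phi t k g) else g.

(* M(mutseq t w) -> M(t), along the reverse of w; mutating mu t k at k gives
   back t. *)
Fixpoint phi_back (t : qseed) (w : seq 'I_n) (g : lattice) : lattice :=
  if w is k :: w' then phi (mu t k) k (phi_back (mu t k) w' g) else g.

End Seeds.

(* A skew-field of fractions of A, which is unique up to a unique isomorphism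
   over A. *)
Record skew_field_of_fractions (A : nzRingType) := SkewFieldOfFractions {
  sf_ring :> unitRingType;
  sf_unit : forall x : sf_ring, x != 0 -> x \is a GRing.unit;
  sf_in : {rmorphism A -> sf_ring};
  sf_in_inj : injective sf_in;
  sf_frac : forall x : sf_ring, exists a b, b != 0 /\ x = sf_in a / sf_in b
}.

Section ClusterStructure.
Variables (n m : nat).
Variable F : forall t : qseed n m, skew_field_of_fractions (LP t).

Local Notation vertex := ('I_(n + m)).
Local Notation uf := (@lshift n m).
Local Notation lattice := ('cV[int]_(n + m)).

Definition inF (t : qseed n m) (z : LP t) : F t := sf_in (F t) z.

Definition Xvar (t : qseed n m) (i : vertex) : F t := inF (Xmon t (bas i)).

(* The isomorphism F(mu t k) -> F(t) of algebras over Z[q^(1/2), q^(-1/2)],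
   determined by the images of the generators, together with its inverse. *)
Record mutation_iso (t : qseed n m) (k : 'I_n) := MutationIso {
  mi_fun :> {rmorphism F (mu t k) -> F t};
  mi_inv : F t -> F (mu t k);
  mi_funK : cancel mi_fun mi_inv;
  mi_invK : cancel mi_inv mi_fun;
  mi_scalar : forall c : qring, mi_fun (inF (c%:A : LP (mu t k))) = inF (c%:A : LP t);
  mi_X : forall i, i != uf k -> mi_fun (Xvar (mu t k) i) = Xvar t i;
  mi_Xk : mi_fun (Xvar (mu t k) (uf k)) =
    inF (Xmon t (- bas (uf k) + \sum_j pos (- Bt t j k) *: bas j)
       + Xmon t (- bas (uf k) + \sum_j pos (Bt t j k) *: bas j))
}.

Variable mustar : forall t k, mutation_iso t k.

Fixpoint mustar_seq (t : qseed n m) (w : seq 'I_n) : F (mutseq t w) -> F t :=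
  match w return F (mutseq t w) -> F t with
  | [::] => id
  | k :: w' => fun x => mustar t k (@mustar_seq (mu t k) w' x)
  end.

Fixpoint mustar_seq_inv (t : qseed n m) (w : seq 'I_n) : F t -> F (mutseq t w) :=
  match w return F t -> F (mutseq t w) with
  | [::] => id
  | k :: w' => fun x => @mustar_seq_inv (mu t k) w' (mi_inv (mustar t k) x)
  end.

Definition in_LP (t : qseed n m) (x : F t) : Prop := exists z : LP t, x = inF z.

Definition degree (t : qseed n m) (x : F t) (g : lattice) : Prop :=
  exists z : LP t, x = inF z /\ LP_degree z g.

Definition pointed (t : qseed n m) (g : lattice) (x : F t) : Prop :=
  exists z : LP t, x = inF z /\ LP_pointed g z.

(* Standing fact on the seeds of Delta^+ (t0): each of their variables, expanded
   at any of these seeds, is pointed. *)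
Definition cluster_variables_pointed (t0 : qseed n m) : Prop :=
  forall t, in_Delta t0 t -> forall (w : seq 'I_n) (i : vertex),
    exists g, pointed g (mustar_seq (Xvar (mutseq t w) i)).

(* For x in F(t): compatibly pointed at t, mutseq t w. *)
Definition compatibly_pointed_to (t : qseed n m) (w : seq 'I_n) (x : F t) : Prop :=
  [/\ in_LP x, in_LP (mustar_seq_inv w x)
    & exists g, pointed g x /\ pointed (phi_seq t w g) (mustar_seq_inv w x)].

(* For x in F(t): compatibly pointed at mutseq t w, t. *)
Definition compatibly_pointed_from (t : qseed n m) (w : seq 'I_n) (x : F t) : Prop :=
  [/\ in_LP x, in_LP (mustar_seq_inv w x)
    & exists g, pointed g (mustar_seq_inv w x) /\ pointed (phi_back t w g) x].

Definition degree_uf_opp (t : qseed n m) (x : F t) (k : 'I_n) : Prop :=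
  exists g, degree x g /\ forall j, g (uf j) 0 = - (j == k)%:R.

(* I_k(t) when t[1] is mutseq t w. *)
Definition Ivar (t : qseed n m) (w : seq 'I_n) (s : {perm 'I_n}) (k : 'I_n) : F t :=
  mustar_seq (Xvar (mutseq t w) (uf (s k))).

(* t[1] is mutseq t w, with permutation s. *)
Definition is_shift (t : qseed n m) (w : seq 'I_n) (s : {perm 'I_n}) : Prop :=
  forall k, degree_uf_opp (Ivar t w s k) k.

(* t[-1] is mutseq t w, with permutation s: the I_k of that seed are the
   X_(s k)(t), transported from F(t). *)
Definition is_unshift (t : qseed n m) (w : seq 'I_n) (s : {perm 'I_n}) : Prop :=
  forall k, degree_uf_opp (mustar_seq_inv w (Xvar t (uf (s k)))) k.

Definition injective_reachable (t : qseed n m) : Prop :=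
  exists w s, is_shift t w s.

End ClusterStructure.

(* Main.v *)
(* Compare the two seeds through degrees. The degrees at [s] of the cluster variables
   of [t] form a matrix [G] with [G *m Bt t = Bt s *m C]; pointedness of the exchange
   relations makes the columns of [C] sign-coherent, and the compatibility of [Bt] and
   [La], invariant under mutation, gives [C^T D G = D] on the unfrozen part. An induction
   on mutation sequences then shows that, restricted to the direction [Y_k], the cluster
   variables of any seed are monomials at [s] or become monomials at [mu s k]; hence
   their degrees transform by [phi].
   When [s = t[-1]], [C] is minus a permutation matrix. If [Z] has the degrees of [A ^+ d]
   at both seeds, its support at [t] is bounded in every direction, so [Z - A ^+ d] is
   a combination of at most [d] consecutive terms on a line of direction [Y_k]. Multiplied
   by [X_k ^+ d] and restricted at [s] to lowest terms, this is too short to be divisible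
   by the d-th power of a binomial, so it vanishes. *)

Require Import Defs.
From mathcomp Require Import all_boot all_order all_algebra all_fingroup.
From mathcomp Require Import finmap.
From mathcomp Require Import monalg.
From mathcomp Require Import ring lra zify.
From Stdlib Require Import ProofIrrelevance.
Import Defs.

Set Implicit Arguments.
Unset Strict Implicit.
Unset Printing Implicit Defensive.

Import Order.TTheory GRing.Theory Num.Theory.
Local Open Scope ring_scope.

(** * Seeds, degrees and weights *)

(** Both parts are one statement about two seeds with [t = s[1]]: the first part reads it from [t],
    the second from [s]. Compatible pointedness enters only through the degree of [Z] at the other
    seed. Since [phi] commutes with natural multiples and follows the degrees of a cluster variable
    from seed to seed, that degree is [d] times the degree of [A] there. That [phi] follows these
    degrees is derived from the pointedness of cluster variables. The tool is a linear weight that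
    vanishes on [Y_k] and is positive on the other [Y_j]. Mutation at [k] preserves it, and lowest
    components multiply because the tori are domains. The lowest component of a pointed element
    consists of its terms in the sole direction of [Y_k], where mutation at [k] is explicit. The
    passage to the shift reverses the order: [G] sends the degree of [Y_(sigma i)] at [t] to minus
    the degree of [Y_i] at [s]. Being pointed bounds a support on one side, so being pointed at both
    seeds bounds it on both sides. *)

Section SeedForm.
Variables n m : nat.
Local Notation vertex := ('I_(n + m)).
Local Notation uf := (@lshift n m).
Local Notation lattice := ('cV[int]_(n + m)).
Implicit Types (t b : qseed n m) (g h x y : lattice) (a : 'cV[int]_n) (k : 'I_n).

Lemma formZl (L : 'M[int]_(n + m)) (c : int) x y : form L (c *: x) y = c * form L x y.
Proof. by rewrite /form linearZ /= -!scalemxAl mxE. Qed.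

Lemma formZr (L : 'M[int]_(n + m)) (c : int) x y : form L x (c *: y) = c * form L x y.
Proof. by rewrite /form -scalemxAr mxE. Qed.

Lemma formNl (L : 'M[int]_(n + m)) x y : form L (- x) y = - form L x y.
Proof. by rewrite -scaleN1r formZl mulN1r. Qed.

Lemma formNr (L : 'M[int]_(n + m)) x y : form L x (- y) = - form L x y.
Proof. by rewrite -scaleN1r formZr mulN1r. Qed.

Lemma formC t x y : form (La t) x y = - form (La t) y x.
Proof.
rewrite /form -[in RHS](trmxK (La t)) La_skew.
have -> : y^T *m (- La t)^T *m x = (x^T *m (- La t) *m y)^T.
  by rewrite !trmx_mul trmxK mulmxA.
by rewrite [in RHS]mxE mulmxN mulNmx [in RHS]mxE opprK.
Qed.

Lemma formxx t x : form (La t) x x = 0.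
Proof. by move: (formC t x x); lia. Qed.

Lemma mulmx_bas p (A : 'M[int]_(p, n + m)) i : A *m bas i = col i A.
Proof. by rewrite colE. Qed.

Lemma form_bas (L : 'M[int]_(n + m)) (i j : vertex) : form L (bas i) (bas j) = L i j.
Proof. by rewrite /form trmx_delta -rowE -colE !mxE. Qed.

Lemma basE (i j : vertex) : bas i j 0 = (j == i)%:R.
Proof. by rewrite mxE eqxx andbT. Qed.

Lemma sum_bas (c : vertex -> int) : \sum_j c j *: bas j = \col_j c j :> lattice.
Proof.
apply/matrixP => i j; rewrite summxE (bigD1 i) //= big1 => [|l li].
  by rewrite !mxE ord1 !eqxx mulr1 addr0.
by rewrite !mxE eq_sym (negbTE li) mulr0.
Qed.

Lemma lattice_sum_bas h : h = \sum_j h j 0 *: bas j.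
Proof. by rewrite sum_bas; apply/matrixP => i j; rewrite mxE ord1. Qed.

Lemma Btkk t k : Bt t (uf k) k = 0.
Proof.
have [d [d0 dB]] := Bt_skew t; move: (dB k k) (d0 k); rewrite !mxE; nia.
Qed.

(* The entry [d'_j] of the diagonal matrix [D'(t)]. *)
Definition diagD t j : int := ((Bt t)^T *m La t) j (uf j).

Lemma diagD_gt0 t j : 0 < diagD t j.
Proof.
have [d [d0 e]] := Bt_La_compatible t.
by rewrite /diagD e row_mxEl mxE eqxx mulr1n.
Qed.

(** Compatibility in coordinates: pairing with the degree of [Y_j] reads off the coordinate at
    [uf j], up to a positive factor. *)
Lemma form_Bt t a h :
  form (La t) (Bt t *m a) h = \sum_j diagD t j * a j 0 * h (uf j) 0.
Proof.
have [d [d0 e]] := Bt_La_compatible t.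
have dE j : diagD t j = d 0 j by rewrite /diagD e row_mxEl mxE eqxx mulr1n.
rewrite /form trmx_mul -(mulmxA a^T) e -[in LHS](vsubmxK h) -mulmxA mul_row_col.
rewrite mul0mx addr0 mul_diag_mx mxE; apply: eq_bigr => j _.
by rewrite !mxE dE mulrA [a j 0 * _]mulrC.
Qed.

Lemma form_Bt_bas t a k : form (La t) (Bt t *m a) (bas (uf k)) = diagD t k * a k 0.
Proof.
rewrite form_Bt (bigD1 k) //= basE eqxx mulr1 big1 ?addr0 // => j jk.
by rewrite basE (inj_eq (@lshift_inj _ _)) (negbTE jk) mulr0.
Qed.

Definition ydeg t k : lattice := col k (Bt t).

Lemma ydegE t k : ydeg t k = Bt t *m delta_mx k 0.
Proof. by rewrite /ydeg colE. Qed.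

Lemma form_ydeg t k h : form (La t) (ydeg t k) h = diagD t k * h (uf k) 0.
Proof.
rewrite ydegE form_Bt (bigD1 k) //= mxE !eqxx mulr1 big1 ?addr0 // => j jk.
by rewrite mxE (negbTE jk) mulr0 mul0r.
Qed.

Definition xneg t k : lattice := \col_i pos (- Bt t i k).
Definition xpos t k : lattice := \col_i pos (Bt t i k).
(* The degrees of the two monomials of the mutated variable [X_k(mu t k)]. *)
Definition mneg t k : lattice := - bas (uf k) + xneg t k.
Definition mpos t k : lattice := - bas (uf k) + xpos t k.

Lemma xposE t k : xpos t k = xneg t k + ydeg t k.
Proof. by apply/matrixP => i j; rewrite !mxE /pos; lia. Qed.

Lemma mposE t k : mpos t k = mneg t k + ydeg t k.
Proof. by rewrite /mpos xposE addrA. Qed.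

Lemma xneg_k t k : xneg t k (uf k) 0 = 0.
Proof. by rewrite mxE Btkk. Qed.

Lemma xpos_k t k : xpos t k (uf k) 0 = 0.
Proof. by rewrite mxE Btkk. Qed.

Lemma ydeg_k t k : ydeg t k (uf k) 0 = 0.
Proof. by rewrite mxE Btkk. Qed.

Lemma mneg_k t k : mneg t k (uf k) 0 = -1.
Proof. by rewrite mxE xneg_k mxE basE eqxx addr0. Qed.

Lemma xneg_ge0 t k i : 0 <= xneg t k i 0.
Proof. by rewrite mxE /pos; lia. Qed.

Lemma xpos_ge0 t k i : 0 <= xpos t k i 0.
Proof. by rewrite mxE /pos; lia. Qed.

(** The change of basis to the [f'_i]: it turns coordinates at [mu t k] into coordinates at [t]. It
    is linear, unlike [phi]. *)
Definition mutE t k : 'M[int]_(n + m) := \matrix_(i, j) mut_bas (Bt t) k j i 0.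

Lemma mutE_bas t k i : mutE t k *m bas i = mut_bas (Bt t) k i.
Proof. by rewrite mulmx_bas; apply/matrixP => j l; rewrite !mxE ord1. Qed.

Lemma mut_basE t k i :
  mut_bas (Bt t) k i = if i == uf k then mneg t k else bas i.
Proof. by rewrite /mut_bas sum_bas. Qed.

Lemma mutEE t k h : mutE t k *m h = h + h (uf k) 0 *: (mneg t k - bas (uf k)).
Proof.
have -> : mutE t k = 1%:M + (mneg t k - bas (uf k)) *m delta_mx 0 (uf k).
  apply/matrixP => i j; rewrite mxE mut_basE [RHS]mxE [in RHS]mxE [X in _ = _ + X]mxE.
  rewrite big_ord1 [delta_mx _ _ _ _]mxE eqxx /=.
  case: eqVneq => [->|jk]; last by rewrite mulr0 addr0 basE.
  by rewrite mulr1 [in RHS]mxE [(- bas _) _ _]mxE basE [RHS]addrC subrK.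
rewrite mulmxDl mul1mx -mulmxA -rowE; congr (_ + _).
by apply/matrixP => i j; rewrite ord1 [LHS]mxE [RHS]mxE big_ord1 mulrC [row _ _ _ _]mxE.
Qed.

Lemma mutE_id t k h : h (uf k) 0 = 0 -> mutE t k *m h = h.
Proof. by move=> h0; rewrite mutEE h0 scale0r addr0. Qed.

(* [t'] carries the exchange matrix and the form of [mu t k]; unlike an equality
   of seeds, this relation between [t] and [t'] is visibly symmetric. *)
Definition seed_adj t t' k :=
  Bt t' = mutB (Bt t) k /\ La t' = mutL (Bt t) (La t) k.

Lemma seed_adj_mu t k : seed_adj t (mu t k) k.
Proof. by []. Qed.

Section Adjacent.
Variables (t t' : qseed n m) (k : 'I_n).
Hypothesis adj : seed_adj t t' k.

Lemma adj_Bt i j : Bt t' i j = if (i == uf k) || (j == k) then - Bt t i j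
  else Bt t i j + Bt t i k * pos (Bt t (uf k) j) + pos (- Bt t i k) * Bt t (uf k) j.
Proof. by case: adj => -> _; rewrite mxE. Qed.

Lemma adj_Bt_k i : Bt t' i k = - Bt t i k.
Proof. by rewrite adj_Bt eqxx orbT. Qed.

Lemma adj_xneg : xneg t' k = xpos t k.
Proof. by apply/matrixP => i j; rewrite !mxE adj_Bt_k opprK. Qed.

Lemma adj_xpos : xpos t' k = xneg t k.
Proof. by apply/matrixP => i j; rewrite !mxE adj_Bt_k. Qed.

Lemma adj_ydeg : ydeg t' k = - ydeg t k.
Proof. by apply/matrixP => i j; rewrite !mxE adj_Bt_k. Qed.

Lemma adj_form x y : form (La t') x y = form (La t) (mutE t k *m x) (mutE t k *m y).
Proof.
suff -> : La t' = (mutE t k)^T *m La t *m mutE t k.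
  by rewrite /form trmx_mul !mulmxA.
case: adj => _ ->; apply/matrixP => i j; rewrite mxE /form -!mutE_bas trmx_mul.
by rewrite trmx_delta -!mulmxA -rowE !mulmxA -colE [LHS]mxE mxE.
Qed.

Lemma adj_ydeg_j j : j != k ->
  mutE t k *m ydeg t' j = ydeg t j + pos (Bt t (uf k) j) *: ydeg t k.
Proof.
move=> jk; rewrite mutEE; apply/matrixP => i l; rewrite ord1 !mxE !adj_Bt !eqxx (negbTE jk) /=.
rewrite orbF; case: eqVneq => [->|ik] /=; first by rewrite Btkk oppr0 [pos 0]maxxx; ring.
by ring.
Qed.

(** The invariant is the pairing of [ydeg] with its basis vector. At [j = k] two signs cancel;
    elsewhere the added multiple of [ydeg t k] pairs to zero with [bas (uf j)]. *)
Lemma adj_diagD j : diagD t' j = diagD t j.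
Proof.
have H s : diagD s j = form (La s) (ydeg s j) (bas (uf j)).
  by rewrite form_ydeg basE eqxx mulr1.
rewrite H adj_form mutE_bas mut_basE (inj_eq (@lshift_inj _ _)).
case: eqVneq => [->|jk]; last first.
  rewrite adj_ydeg_j // formDl formZl !form_ydeg !basE eqxx.
  by rewrite (inj_eq (@lshift_inj _ _)) eq_sym (negbTE jk) mulr1 !mulr0 addr0.
rewrite (mutE_id t (ydeg_k t' k)) adj_ydeg formNl form_ydeg mneg_k.
by ring.
Qed.

(** [xneg] and [xpos] are exchanged at [t'], so the round trip is a shear along [ydeg t k] and not
    the identity. The shear preserves the form, which gives the [La] half of [seed_adj_sym]. *)
Lemma mutE_invol x : mutE t k *m (mutE t' k *m x) = x + x (uf k) 0 *: ydeg t k.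
Proof.
rewrite [mutE t' k *m x]mutEE mulmxDr mutEE -addrA; congr (_ + _).
rewrite -scalemxAr -scalerDr; congr (_ *: _).
rewrite mutEE /mneg adj_xneg xposE; apply/matrixP => i j.
by rewrite !mxE !eqxx !Btkk /pos; lia.
Qed.

Lemma seed_adj_sym : seed_adj t' t k.
Proof.
split; apply/matrixP => i j.
  rewrite mxE; case: ifP => [c|/negbT]; first by rewrite adj_Bt c opprK.
  rewrite negb_or => /andP[/negbTE ik /negbTE jk].
  rewrite !adj_Bt !eqxx ik jk /= /pos.
  by nia.
rewrite mxE adj_form -!mutE_bas !mutE_invol formDl !formDr.
rewrite !formZl !formZr formxx form_bas form_ydeg formC form_ydeg !basE.
by rewrite [uf k == i]eq_sym [uf k == j]eq_sym; ring.
Qed.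

End Adjacent.

(** Seeds carry proofs of their axioms; by proof irrelevance the two matrices determine the seed.
    Hence [mu] is involutive up to Leibniz equality. *)
Lemma seed_adj_uniq t1 t2 t k : seed_adj t t1 k -> seed_adj t t2 k -> t1 = t2.
Proof.
move=> [eB1 eL1] [eB2 eL2]; move: (etrans eB1 (esym eB2)) (etrans eL1 (esym eL2)).
move: t1 t2 {eB1 eL1 eB2 eL2} => [B1 L1 r1 s1 c1 a1] [B2 L2 r2 s2 c2 a2] /= eB eL.
subst B2 L2.
by rewrite (proof_irrelevance _ r1 r2) (proof_irrelevance _ s1 s2)
  (proof_irrelevance _ c1 c2) (proof_irrelevance _ a1 a2).
Qed.

Lemma mu_invol t k : mu (mu t k) k = t.
Proof.
apply: (@seed_adj_uniq _ _ (mu t k) k) => //.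
exact/seed_adj_sym/seed_adj_mu.
Qed.

(* For [P = pred1 k] the level sets of [wt t P] inside a cone [g + B N^n] fix the
   exponent of [Y_k]; for [P = predC1 k] the lowest one is the ray from [g] in the
   direction of [Y_k]. *)
Definition wt t (P : pred 'I_n) h : int := form (La t) h (\sum_(j | P j) bas (uf j)).

Lemma wtD t P x y : wt t P (x + y) = wt t P x + wt t P y.
Proof. exact: formDl. Qed.

Lemma wt_Bt t (P : pred 'I_n) a : wt t P (Bt t *m a) = \sum_(j | P j) diagD t j * a j 0.
Proof.
rewrite /wt (big_morph (form (La t) (Bt t *m a)) (formDr _ _) (form0r _ _)).
by apply: eq_bigr => j _; rewrite form_Bt_bas.
Qed.

Lemma wt_ydegC t k : wt t (predC1 k) (ydeg t k) = 0.
Proof.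
by rewrite ydegE wt_Bt big1 // => j /= jk; rewrite mxE (negbTE jk) mulr0.
Qed.

Lemma wt_ydeg t k : wt t (pred1 k) (ydeg t k) = diagD t k.
Proof. by rewrite ydegE wt_Bt big_pred1_eq mxE !eqxx mulr1. Qed.

(** Pairing with [bas (uf i)] recovers [diagD t i * a i 0]. *)
Lemma Bt_inj t a a' : Bt t *m a = Bt t *m a' -> a = a'.
Proof.
move=> e; apply/matrixP => i j; rewrite ord1.
move: (form_Bt_bas t a i) (diagD_gt0 t i); rewrite e form_Bt_bas => + d0.
by move/mulfI => /(_ (lt0r_neq0 d0)).
Qed.

(** The weight is a pairing with basis vectors other than that of [k], and mutation at [k] moves no
    other: the two seeds carry the same grading. *)
Lemma adj_wt t t' k h : seed_adj t t' k ->
  wt t' (predC1 k) h = wt t (predC1 k) (mutE t k *m h).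
Proof.
move=> adj; rewrite /wt (adj_form adj); congr (form _ _ _).
apply: mutE_id; rewrite summxE big1 // => j /= jk.
by rewrite basE (inj_eq (@lshift_inj _ _)) eq_sym (negbTE jk).
Qed.

(** This is [preceq t h g], with an integer vector in place of a natural one so that coordinates can
    be subtracted and compared linearly. *)
Definition dom t g h := exists a, (forall i, 0 <= a i 0) /\ h = g + Bt t *m a.

Lemma dom_refl t g : dom t g g.
Proof. by exists 0; rewrite mulmx0 addr0; split=> // i; rewrite mxE. Qed.

Lemma domD t g h x y : dom t g x -> dom t h y -> dom t (g + h) (x + y).
Proof.
move=> [a [a0 ->]] [a' [a'0 ->]]; exists (a + a'); rewrite mulmxDr addrACA; split=> // i.
by rewrite mxE addr_ge0.
Qed.

Lemma dom_trans t g h x : dom t g h -> dom t h x -> dom t g x.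
Proof.
move=> [a [a0 ->]] [a' [a'0 ->]]; exists (a + a'); rewrite mulmxDr addrA; split=> // i.
by rewrite mxE addr_ge0.
Qed.

Lemma dom_anti t g h : dom t g h -> dom t h g -> g = h.
Proof.
move=> [a [a0 ->]] [a' [a'0 e]].
have : a + a' = 0.
  apply: (@Bt_inj t); rewrite mulmx0 mulmxDr; apply: (addrI g).
  by rewrite addrA -e addr0.
move=> z; suff -> : a = 0 by rewrite mulmx0 addr0.
apply/matrixP => i j; move/matrixP: z => /(_ i 0); rewrite ord1 !mxE.
by move/eqP; rewrite paddr_eq0 // => /andP[/eqP].
Qed.

Lemma dom_wt t P g h : dom t g h -> wt t P g <= wt t P h.
Proof.
move=> [a [a0 ->]]; rewrite wtD wt_Bt lerDl sumr_ge0 // => j _.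
by rewrite mulr_ge0 // ltW // diagD_gt0.
Qed.

Lemma dom_wt_eq t g h : dom t g h -> wt t predT h <= wt t predT g -> g = h.
Proof.
move=> [a [a0 ->]]; rewrite wtD wt_Bt gerDl => le0.
have d0 j : 0 <= diagD t j * a j 0 by rewrite mulr_ge0 // ltW // diagD_gt0.
suff -> : a = 0 by rewrite mulmx0 addr0.
have /eqP : \sum_j diagD t j * a j 0 = 0 by apply/eqP; rewrite eq_le le0 sumr_ge0.
rewrite psumr_eq0 // => /allP z; apply/matrixP => i j; rewrite ord1 mxE.
by have := z i (mem_index_enum i); rewrite mulf_eq0 gt_eqF ?diagD_gt0 // => /eqP.
Qed.

End SeedForm.

(** * Graded components in quantum tori *)

(* The quantum tori [LP t] of all seeds, seen through their coefficients. *)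
Record quantum_tori (n m : nat) := QuantumTori {
  scal : comNzRingType;
  vp : int -> scal;
  vp0 : vp 0 = 1;
  vpD : forall a b, vp (a + b) = vp a * vp b;
  vp_inj : injective vp;
  alg : qseed n m -> algType scal;
  coef : forall t, alg t -> 'cV[int]_(n + m) -> scal;
  supp : forall t, alg t -> seq 'cV[int]_(n + m);
  mon : forall t, 'cV[int]_(n + m) -> alg t;
  coefD : forall t (x y : alg t) h, coef (x + y) h = coef x h + coef y h;
  coefZ : forall t c (x : alg t) h, coef (c *: x) h = c * coef x h;
  coef_mon : forall t g h, coef (mon t g) h = (g == h)%:R;
  mon0 : forall t, mon t 0 = 1;
  monM : forall t g h, mon t g * mon t h = vp (form (La t) g h) *: mon t (g + h);
  supp_uniq : forall t (x : alg t), uniq (supp x);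
  alg_sum : forall t (x : alg t), x = \sum_(h <- supp x) coef x h *: mon t h
}.

Lemma big_seq_single (V : nmodType) (I : eqType) (s : seq I) (i : I) (f : I -> V) :
  uniq s -> (i \notin s -> f i = 0) -> (forall j, j != i -> f j = 0) ->
  \sum_(j <- s) f j = f i.
Proof.
move=> us fi fj; have [si|/[dup] si /fi ->] := boolP (i \in s).
  by rewrite (bigD1_seq i) //= big1 ?addr0.
by rewrite big1_seq // => j /= js; apply: fj; apply: contraTneq js => ->.
Qed.

Section Grading.
Variables (n m : nat) (Q : quantum_tori n m) (t : qseed n m).
Local Notation M := ('cV[int]_(n + m)).
Local Notation A := (alg Q t).
Local Notation X := (mon Q t).
Implicit Types (x y z : A) (a b g h : M) (c d e : int).

Lemma coef0 h : coef (0 : A) h = 0.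
Proof. by apply: (addrI (coef (0 : A) h)); rewrite -coefD !addr0. Qed.

Lemma coef_sum I (r : seq I) P (f : I -> A) h :
  coef (\sum_(i <- r | P i) f i) h = \sum_(i <- r | P i) coef (f i) h.
Proof. exact: (big_morph (fun x => coef x h) (fun x y => coefD x y h) (coef0 h)). Qed.

Lemma coefN x h : coef (- x) h = - coef x h.
Proof. by rewrite -scaleN1r coefZ mulN1r. Qed.

Lemma coef_out x h : h \notin supp x -> coef x h = 0.
Proof.
move=> hx; rewrite (alg_sum x) coef_sum big_seq big1 // => g gx.
rewrite coefZ coef_mon; case: eqP => [e|_]; last by rewrite mulr0.
by move: hx; rewrite -e gx.
Qed.

Lemma coefP x y : (forall h, coef x h = coef y h) -> x = y.
Proof.
move=> e; apply/eqP; rewrite -subr_eq0 (alg_sum (x - y)) big1 // => h _.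
by rewrite coefD coefN e subrr scale0r.
Qed.

Lemma coef_monX g : coef (X g) g = 1.
Proof. by rewrite coef_mon eqxx. Qed.

Lemma supp_mon g h : coef (X g) h <> 0 -> h = g.
Proof. by rewrite coef_mon; case: eqVneq => [->|]. Qed.

Lemma scal1_neq0 : (1 : scal Q) <> 0.
Proof. exact/eqP/oner_neq0. Qed.

Lemma vpK c : vp Q (- c) * vp Q c = 1.
Proof. by rewrite -vpD addNr vp0. Qed.

Lemma scalevK c x : vp Q (- c) *: (vp Q c *: x) = x.
Proof. by rewrite scalerA vpK scale1r. Qed.

Lemma scalev_eq0 c x : vp Q c *: x = 0 -> x = 0.
Proof. by move=> e; rewrite -(scalevK c x) e scaler0. Qed.

Lemma monD g h : X (g + h) = vp Q (- form (La t) g h) *: (X g * X h).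
Proof. by rewrite monM scalevK. Qed.

Lemma coef1 h : coef (1 : A) h = (0 == h)%:R.
Proof. by rewrite -(mon0 Q t) coef_mon. Qed.

Lemma supp_coefZ (k : scal Q) x h : coef (k *: x) h <> 0 -> coef x h <> 0.
Proof. by rewrite coefZ => H e; apply: H; rewrite e mulr0. Qed.

Lemma alg_mulE x y : x * y = \sum_(a <- supp x) \sum_(b <- supp y)
  (coef x a * coef y b * vp Q (form (La t) a b)) *: X (a + b).
Proof.
rewrite {1}(alg_sum x) mulr_suml; apply: eq_bigr => a _.
rewrite {1}(alg_sum y) mulr_sumr; apply: eq_bigr => b _.
by rewrite -scalerAl -scalerAr monM !scalerA.
Qed.

Lemma coefM x y h : coef (x * y) h = \sum_(a <- supp x) \sum_(b <- supp y)
  coef x a * coef y b * vp Q (form (La t) a b) * (a + b == h)%:R.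
Proof.
rewrite alg_mulE coef_sum; apply: eq_bigr => a _; rewrite coef_sum.
by apply: eq_bigr => b _; rewrite coefZ coef_mon.
Qed.

Lemma suppM x y h : coef (x * y) h <> 0 ->
  exists a b, [/\ coef x a <> 0, coef y b <> 0 & h = a + b].
Proof.
rewrite coefM => H.
have [/hasP[a ax /hasP[b yb /and3P[/eqP xa /eqP yb' /eqP e]]]|/hasPn N] := boolP (has
  (fun a => has (fun b => [&& coef x a != 0, coef y b != 0 & a + b == h]) (supp y))
  (supp x)); first by exists a, b.
case: H; rewrite big_seq big1 // => a /N /hasPn Na.
rewrite big_seq big1 // => b /Na; case: (a + b =P h) => _; last by rewrite mulr0.
by rewrite andbT negb_and !negbK => /orP[] /eqP ->; rewrite ?mulr0 !mul0r.
Qed.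

Lemma coefM_single x y a b :
  (forall a' b', coef x a' <> 0 -> coef y b' <> 0 -> a' + b' = a + b -> a' = a /\ b' = b) ->
  coef (x * y) (a + b) = vp Q (form (La t) a b) * (coef x a * coef y b).
Proof.
move=> H; rewrite coefM.
have Z a' b' : (a' != a) || (b' != b) ->
    coef x a' * coef y b' * vp Q (form (La t) a' b') * (a' + b' == a + b)%:R = 0.
  move=> ne; case: eqP => [e|_]; last by rewrite mulr0.
  have [/eqP->|/eqP xa] := boolP (coef x a' == 0); first by rewrite !mul0r.
  have [/eqP->|/eqP yb] := boolP (coef y b' == 0); first by rewrite mulr0 !mul0r.
  by move: ne; have [-> ->] := H _ _ xa yb e; rewrite !eqxx.
rewrite (big_seq_single (i := a)) ?supp_uniq //; first last.
- by move=> a' na; rewrite big1 // => b' _; rewrite Z ?na.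
- by move/coef_out => ->; rewrite big1 // => b' _; rewrite !mul0r.
rewrite (big_seq_single (i := b)) ?supp_uniq //; first last.
- by move=> b' nb; rewrite Z ?nb ?orbT.
- by move/coef_out => ->; rewrite mulr0 !mul0r.
by rewrite eqxx mulr1 mulrC.
Qed.

Definition gcomp (w : M -> int) c (x : A) : A :=
  \sum_(h <- supp x | w h == c) coef x h *: X h.

Lemma coef_gcomp w c x h : coef (gcomp w c x) h = if w h == c then coef x h else 0.
Proof.
rewrite /gcomp coef_sum big_mkcond (big_seq_single (i := h)) ?supp_uniq //=.
- by rewrite coefZ coef_mon eqxx mulr1.
- by move/coef_out => ->; rewrite scale0r coef0 if_same.
- by move=> g gh; rewrite coefZ coef_mon (negbTE gh) mulr0 if_same.
Qed.

Lemma gcompD w c x y : gcomp w c (x + y) = gcomp w c x + gcomp w c y.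
Proof.
apply: coefP => h; rewrite coefD !coef_gcomp coefD.
by case: ifP => // _; rewrite addr0.
Qed.

Lemma gcomp0 w c : gcomp w c 0 = 0.
Proof. by apply: coefP => h; rewrite coef_gcomp coef0 if_same. Qed.

Lemma gcompZ w c (k : scal Q) x : gcomp w c (k *: x) = k *: gcomp w c x.
Proof.
apply: coefP => h; rewrite coefZ !coef_gcomp coefZ.
by case: ifP => // _; rewrite mulr0.
Qed.

Definition lowb (w : M -> int) c x := forall h, coef x h <> 0 -> c <= w h.
Definition homog (w : M -> int) c x := forall h, coef x h <> 0 -> w h = c.

Lemma gcomp_id w c x : homog w c x -> gcomp w c x = x.
Proof.
move=> hx; apply: coefP => h; rewrite coef_gcomp; case: eqP => // ne.
by case: (eqVneq (coef x h) 0) => // /eqP /hx.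
Qed.

Lemma gcomp_ne w c d x : homog w c x -> c <> d -> gcomp w d x = 0.
Proof.
move=> hx cd; apply: coefP => h; rewrite coef_gcomp coef0; case: eqP => // e.
by case: (eqVneq (coef x h) 0) => // /eqP /hx; rewrite e => /esym.
Qed.

Lemma gcomp_lt w c d x : lowb w c x -> d < c -> gcomp w d x = 0.
Proof.
move=> hx cd; apply: coefP => h; rewrite coef_gcomp coef0; case: eqP => // e.
by case: (eqVneq (coef x h) 0) => // /eqP /hx; rewrite e leNgt cd.
Qed.

Lemma homog_lowb w c x : homog w c x -> lowb w c x.
Proof. by move=> hx h /hx ->. Qed.

Section Weight.
Variable w : M -> int.
Hypothesis wD : forall a b, w (a + b) = w a + w b.

Lemma lowbM c d x y : lowb w c x -> lowb w d y -> lowb w (c + d) (x * y).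
Proof. by move=> hx hy h /suppM[a [b [/hx xa /hy yb ->]]]; rewrite wD lerD. Qed.

Lemma homogM c d x y : homog w c x -> homog w d y -> homog w (c + d) (x * y).
Proof. by move=> hx hy h /suppM[a [b [/hx xa /hy yb ->]]]; rewrite wD xa yb. Qed.

(** Common core of the next two lemmas: no other pair of weights sums to [c + d], either because of
    lower bounds or because one factor is homogeneous. *)
Let gcomp_mul_gen c d x y :
  (forall a b, coef x a <> 0 -> coef y b <> 0 -> w a + w b = c + d -> w a = c /\ w b = d) ->
  gcomp w (c + d) (x * y) = gcomp w c x * gcomp w d y.
Proof.
move=> H; apply: coefP => h; rewrite coef_gcomp.
have -> : gcomp w c x * gcomp w d y = \sum_(a <- supp x | w a == c)
    \sum_(b <- supp y | w b == d) (coef x a * coef y b * vp Q (form (La t) a b)) *: X (a + b).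
  rewrite mulr_suml; apply: eq_bigr => a _; rewrite mulr_sumr; apply: eq_bigr => b _.
  by rewrite -scalerAl -scalerAr monM !scalerA.
rewrite coef_sum coefM [in RHS]big_mkcond /=.
(* An indicator factor, unlike a conditional, distributes over both sums. *)
have -> (u v : scal Q) : (if w h == c + d then u else v) =
    (w h == c + d)%:R * u + (w h != c + d)%:R * v.
  by case: eqP; rewrite mul1r mul0r ?addr0 ?add0r.
rewrite mulr0 addr0 mulr_sumr; apply: eq_bigr => a _.
rewrite mulr_sumr; case: (eqVneq (w a) c) => wa; last first.
  apply: big1 => b _; case: (eqVneq (w h) (c + d)) => wh; last by rewrite mul0r.
  rewrite mul1r; case: eqP => e; last by rewrite mulr0.
  have [/eqP->|/eqP xa] := boolP (coef x a == 0); first by rewrite !mul0r.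
  have [/eqP->|/eqP yb] := boolP (coef y b == 0); first by rewrite mulr0 !mul0r.
  by move: wa; have [|-> _] := H a b xa yb; rewrite ?eqxx // -wD e.
rewrite coef_sum [in RHS]big_mkcond /=; apply: eq_bigr => b _.
rewrite coefZ coef_mon; case: (eqVneq (w b) d) => wb; last first.
  case: (eqVneq (w h) (c + d)) => wh; last by rewrite mul0r.
  rewrite mul1r; case: eqP => e; last by rewrite mulr0.
  by move: wb; rewrite -(inj_eq (addrI c)) -[X in X + w b]wa -wD e wh eqxx.
case: (eqVneq (a + b) h) => [<-|_]; last by rewrite !mulr0.
by rewrite wD wa wb eqxx mul1r.
Qed.

Lemma gcomp_lowM c d x y : lowb w c x -> lowb w d y ->
  gcomp w (c + d) (x * y) = gcomp w c x * gcomp w d y.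
Proof.
move=> hx hy; apply: gcomp_mul_gen => a b /hx xa /hy yb e.
by split; lia.
Qed.

Lemma gcomp_homogMr c d x y : homog w d y -> gcomp w (c + d) (x * y) = gcomp w c x * y.
Proof.
move=> hy; rewrite -{2}(gcomp_id hy); apply: gcomp_mul_gen => a b _ /hy yb e.
by split; lia.
Qed.

Lemma weight0 : w 0 = 0.
Proof. by move: (wD 0 0); rewrite addr0; lia. Qed.

Lemma homog1 : homog w 0 (1 : A).
Proof.
by move=> h; rewrite coef1; case: eqP => // <-; rewrite weight0.
Qed.

Lemma gcomp_lowX c x p : lowb w c x ->
  lowb w (c *+ p) (x ^+ p) /\ gcomp w (c *+ p) (x ^+ p) = gcomp w c x ^+ p.
Proof.
move=> hx; elim: p => [|p [IH1 IH2]].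
  by rewrite !expr0 mulr0n; split; [apply: homog_lowb | apply: gcomp_id]; apply: homog1.
by rewrite !exprS mulrS; split; [apply: lowbM | rewrite gcomp_lowM // IH2].
Qed.

End Weight.

Lemma ex_min_weight w x : x <> 0 ->
  exists2 h, coef x h <> 0 & lowb w (w h) x.
Proof.
move=> x0; pose s := [seq h <- supp x | coef x h != 0].
have hs h : (h \in s) = (coef x h != 0).
  rewrite mem_filter; case: (boolP (h \in supp x)) => [|/coef_out ->].
    by rewrite andbT.
  by rewrite eqxx.
suff [h hx hm] : exists2 h, h \in s & forall h', h' \in s -> w h <= w h'.
  exists h; first by apply/eqP; rewrite -hs.
  by move=> h' /eqP; rewrite -hs => /hm.
have : has predT s.
  apply/negPn/negP => /hasPn N; apply: x0; apply: coefP => h; rewrite coef0.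
  by apply/eqP/negPn/negP; rewrite -hs => /N.
  elim: s {hs} => // a l IH _.
  case: (boolP (has predT l)) => [/IH[h hl hm]|/hasPn N].
    case: (leP (w a) (w h)) => ah.
      exists a; first exact: mem_head.
      by move=> h'; rewrite inE => /orP[/eqP->//|/hm]; apply: le_trans.
    exists h; first by rewrite inE hl orbT.
    by move=> h'; rewrite inE => /orP[/eqP->|/hm//]; apply: ltW.
  exists a; first exact: mem_head.
  by move=> h'; rewrite inE => /orP[/eqP->//|/N].
Qed.

(** The Newton polytope of [x] has width at least [c] in the direction [w]. *)
Definition spread (w : M -> int) c x :=
  exists a b, [/\ coef x a <> 0, coef x b <> 0 & c <= w b - w a].

Lemma spread0 w x : x <> 0 -> spread w 0 x.
Proof. by move=> /(ex_min_weight w)[h hx _]; exists h, h; rewrite subrr. Qed.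

Lemma gcomp_neq0 w x h : coef x h <> 0 -> gcomp w (w h) x <> 0.
Proof.
by move=> hx e; apply: hx; rewrite -(coef0 h) -e coef_gcomp eqxx.
Qed.

Lemma supp_of_gcomp w c x : gcomp w c x <> 0 -> exists2 h, coef x h <> 0 & w h = c.
Proof.
move=> /(ex_min_weight w)[h]; rewrite coef_gcomp; case: eqP => // e hx _.
by exists h.
Qed.

Hypothesis domA : forall x y, x * y = 0 -> x = 0 \/ y = 0.

(** Lowest components have a nonzero product in a domain. Applied to [w] and to [- w], this locates
    both ends of the support of the product. *)
Lemma spreadM w c d x y : (forall a b, w (a + b) = w a + w b) ->
  spread w c x -> spread w d y -> spread w (c + d) (x * y).
Proof.
move=> wD [a1 [a2 [xa1 xa2 ca]]] [b1 [b2 [yb1 yb2 cb]]].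
have x0 : x <> 0 by move=> x0; apply: xa1; rewrite x0 coef0.
have y0 : y <> 0 by move=> y0; apply: yb1; rewrite y0 coef0.
have ext v : (forall a b, v (a + b) = v a + v b) ->
    exists a b h, [/\ lowb v (v a) x, lowb v (v b) y, coef (x * y) h <> 0 & v h = v a + v b].
  move=> vD; have [a xa la] := ex_min_weight v x0; have [b yb lb] := ex_min_weight v y0.
  have : gcomp v (v a + v b) (x * y) <> 0.
    by rewrite gcomp_lowM // => /domA[]; apply: gcomp_neq0.
  by move=> /supp_of_gcomp[h hxy vh]; exists a, b, h.
have [a [b [h [la lb hxy wh]]]] := ext w wD.
have NwD a' b' : - w (a' + b') = - w a' + - w b' by rewrite wD opprD.
have [a' [b' [h' [la' lb' hxy' wh']]]] := ext (fun v => - w v) NwD.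
exists h, h'; split=> //.
move: (la _ xa1) (lb _ yb1) (la' _ xa2) (lb' _ yb2) ca cb wh wh'; lia.
Qed.

Lemma spreadX w c x p : (forall a b, w (a + b) = w a + w b) ->
  x <> 0 -> spread w c x -> spread w (c *+ p) (x ^+ p).
Proof.
move=> wD x0 sx; elim: p => [|p IH]; last by rewrite exprS mulrS; apply: spreadM.
by rewrite expr0 mulr0n; apply: spread0; apply/eqP/oner_neq0.
Qed.

Lemma homog_spread w c d x : homog w c x -> spread w d x -> d <= 0.
Proof. by move=> hx [a [b [/hx-> /hx->]]]; rewrite subrr. Qed.

End Grading.

(** * Pointed elements *)

Section Pointed.
Variables (n m : nat) (Q : quantum_tori n m).
Local Notation uf := (@lshift n m).
Local Notation A := (alg Q).
Implicit Types (t b : qseed n m) (g h : 'cV[int]_(n + m)) (k : 'I_n).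

Lemma homog_mon t w g : homog w (w g) (mon Q t g).
Proof. by move=> h /supp_mon ->. Qed.

Lemma homogZ t w c e (z : A t) : homog w c z -> homog w c (e *: z).
Proof. by move=> hz h /supp_coefZ /hz. Qed.

(** The coefficientwise form of [LP_pointed], inherited directly by normalized products and by
    lowest components. *)
Definition pt t g (z : A t) := coef z g = 1 /\ forall h, coef z h <> 0 -> dom t g h.

Lemma ptX t g : pt g (mon Q t g).
Proof. by split=> [|h /supp_mon ->]; [apply: coef_monX | apply: dom_refl]. Qed.

Lemma pt_uniq t g h (z : A t) : pt g z -> pt h z -> g = h.
Proof.
move=> [zg dg] [zh dh].
by apply: (dom_anti (t := t)); [apply: dg; rewrite zh | apply: dh; rewrite zg];
   apply: scal1_neq0.
Qed.

Lemma coef_domM t g h (x y : A t) :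
  (forall a, coef x a <> 0 -> dom t g a) -> (forall a, coef y a <> 0 -> dom t h a) ->
  coef (x * y) (g + h) = vp Q (form (La t) g h) * (coef x g * coef y h).
Proof.
move=> dx dy; apply: coefM_single => a b /dx xa /dy yb e.
have ea : g = a.
  apply: (dom_anti xa); case: yb => v [v0 eb]; exists v; split=> //.
  by apply: (addIr h); rewrite -e eb -addrA [_ + h]addrC.
by split=> //; move: e; rewrite ea => /addrI.
Qed.

Lemma supp_domM t g h (x y : A t) :
  (forall a, coef x a <> 0 -> dom t g a) -> (forall a, coef y a <> 0 -> dom t h a) ->
  forall a, coef (x * y) a <> 0 -> dom t (g + h) a.
Proof. by move=> dx dy a /suppM[a1 [a2 [/dx d1 /dy d2 ->]]]; apply: domD. Qed.

Lemma ptM t g h (x y : A t) : pt g x -> pt h y ->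
  pt (g + h) (vp Q (- form (La t) g h) *: (x * y)).
Proof.
move=> [xg dx] [yh dy]; split.
  by rewrite coefZ coef_domM // xg yh !mulr1 vpK.
by move=> a /supp_coefZ; apply: supp_domM.
Qed.

Lemma pt_neq0 t g (z : A t) : pt g z -> z <> 0.
Proof. by move=> [zg _] z0; move: zg; rewrite z0 coef0 => /esym; apply: scal1_neq0. Qed.

Lemma pt_lowb t P g (z : A t) : pt g z -> lowb (wt t P) (wt t P g) z.
Proof. by move=> [_ dz] h /dz; apply: dom_wt. Qed.

Lemma pt_gcomp t P g (z : A t) : pt g z -> pt g (gcomp (wt t P) (wt t P g) z).
Proof.
move=> [zg dz]; split; first by rewrite coef_gcomp eqxx.
by move=> h; rewrite coef_gcomp; case: eqP => // _; apply: dz.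
Qed.

End Pointed.

(** * Mutation isomorphisms *)

Section Fields.
Variables (n m : nat) (Q : quantum_tori n m).
Variable F : forall t, skew_field_of_fractions (alg Q t).
Local Notation uf := (@lshift n m).
Local Notation lattice := ('cV[int]_(n + m)).
Local Notation A := (alg Q).
Local Notation X := (mon Q).
Local Notation iF z := (sf_in (F _) z).
Implicit Types (t b r : qseed n m) (g h : lattice) (k : 'I_n).

Lemma frac_dom t (x y : F t) : x * y = 0 -> x = 0 \/ y = 0.
Proof.
have [->|/sf_unit xu] := eqVneq x 0; first by left.
by move=> e; right; rewrite -(mulKr xu y) e mulr0.
Qed.

Lemma iF_neq0 t (z : A t) : z <> 0 -> sf_in (F t) z <> 0.
Proof. by move=> z0 e; apply: z0; apply: (@sf_in_inj _ (F t)); rewrite e rmorph0. Qed.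

Lemma frac_mulI t (x y z : F t) : x <> 0 -> x * y = x * z -> y = z.
Proof. by move/eqP/sf_unit => xu; apply: mulrI. Qed.

Lemma frac_mulIr t (x y z : F t) : x <> 0 -> y * x = z * x -> y = z.
Proof. by move/eqP/sf_unit => xu; apply: mulIr. Qed.

Lemma alg_dom t (x y : A t) : x * y = 0 -> x = 0 \/ y = 0.
Proof.
move=> e; have /frac_dom[] : sf_in (F t) x * sf_in (F t) y = 0 by rewrite -rmorphM e rmorph0.
  by rewrite -(rmorph0 (sf_in (F t))) => /sf_in_inj; left.
by rewrite -(rmorph0 (sf_in (F t))) => /sf_in_inj; right.
Qed.

Lemma alg_mulI t (x y z : A t) : x <> 0 -> x * y = x * z -> y = z.
Proof.
move=> x0 e; apply: (@sf_in_inj _ (F t)); apply: (frac_mulI (iF_neq0 x0)).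
by rewrite -!rmorphM e.
Qed.

Lemma mon_neq0 t g : X t g <> 0.
Proof. exact: pt_neq0 (ptX Q t g). Qed.

(** A predicate and not a bundled morphism, since the composites along words and the inverse
    mutations are plain functions. *)
Record ishom r b (f : F r -> F b) : Prop := IsHom {
  homD : forall x y, f (x + y) = f x + f y;
  homM : forall x y, f (x * y) = f x * f y;
  hom1 : f 1 = 1;
  homS : forall c, f (sf_in (F r) (c%:A)) = sf_in (F b) (c%:A)
}.

Lemma ishom_comp r b c (f : F r -> F b) (g : F c -> F r) :
  ishom f -> ishom g -> ishom (fun x => f (g x)).
Proof.
by move=> [fD fM f1 fS] [gD gM g1 gS]; split=> *; rewrite ?gD ?gM ?g1 ?gS ?fD ?fM ?f1 ?fS.
Qed.

Lemma ishom_inv r b (f : F r -> F b) (g : F b -> F r) :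
  ishom f -> cancel f g -> cancel g f -> ishom g.
Proof.
move=> hf fK gK; split=> [x y|x y||c]; apply: (can_inj fK).
- by rewrite (homD hf) !gK.
- by rewrite (homM hf) !gK.
- by rewrite gK (hom1 hf).
- by rewrite gK (homS hf).
Qed.

Section Hom.
Variables (r b : qseed n m) (f : F r -> F b).
Hypothesis hf : ishom f.

Lemma hom0 : f 0 = 0.
Proof. by apply: (addrI (f 0)); rewrite -(homD hf) !addr0. Qed.

Lemma homB x y : f (x - y) = f x - f y.
Proof. by apply: (addIr (f y)); rewrite -(homD hf) !subrK. Qed.

Lemma homX x p : f (x ^+ p) = f x ^+ p.
Proof. by elim: p => [|p IH]; rewrite ?expr0 ?(hom1 hf) // !exprS (homM hf) IH. Qed.

Lemma hom_eq0 x : f x = 0 -> x = 0.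
Proof.
move=> fx; have [//|/sf_unit xu] := eqVneq x 0; have := hom1 hf.
by rewrite -(divrr xu) (homM hf) fx mul0r => /esym/eqP; rewrite oner_eq0.
Qed.

Lemma hom_inj x y : f x = f y -> x = y.
Proof.
by move=> e; apply/eqP; rewrite -subr_eq0; apply/eqP/hom_eq0; rewrite homB e subrr.
Qed.

Lemma exp_D z1 z2 w1 w2 : f (iF z1) = iF w1 -> f (iF z2) = iF w2 ->
  f (iF (z1 + z2)) = iF (w1 + w2).
Proof. by move=> e1 e2; rewrite !rmorphD (homD hf) e1 e2. Qed.

Lemma exp_M z1 z2 w1 w2 : f (iF z1) = iF w1 -> f (iF z2) = iF w2 ->
  f (iF (z1 * z2)) = iF (w1 * w2).
Proof. by move=> e1 e2; rewrite !rmorphM (homM hf) e1 e2. Qed.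

Lemma exp_Z c z w : f (iF z) = iF w -> f (iF (c *: z)) = iF (c *: w).
Proof. by move=> e; rewrite -mulr_algl -[in RHS]mulr_algl !rmorphM (homM hf) (homS hf) e. Qed.

Lemma exp_X p z w : f (iF z) = iF w -> f (iF (z ^+ p)) = iF (w ^+ p).
Proof. by move=> e; rewrite !rmorphXn homX e. Qed.

Section Closure.
Variables (G : 'M[int]_(n + m)) (P : lattice -> A b -> Prop).
Hypothesis Gform : forall x y, form (La b) (G *m x) (G *m y) = form (La r) x y.
Hypothesis PM : forall g h x y, P g x -> P h y ->
  P (g + h) (vp Q (- form (La b) g h) *: (x * y)).
Hypothesis P1 : P 0 1.

(** [P] is multiplicative in the degree, so the property passes from basis vectors to their
    nonnegative combinations. It is used with [P] saying monomial, [pt], [pt_line] and [low_mon]. *)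
Definition expands h := exists2 z, f (iF (X r h)) = iF z & P (G *m h) z.

Lemma expandsD g h : expands g -> expands h -> expands (g + h).
Proof.
move=> [x ex Px] [y ey Py].
exists (vp Q (- form (La b) (G *m g) (G *m h)) *: (x * y)).
  by rewrite monD Gform; apply: exp_Z; apply: exp_M.
by rewrite mulmxDr; apply: PM.
Qed.

Lemma expands0 : expands 0.
Proof. by exists 1; rewrite ?mulmx0 // mon0 !rmorph1 (hom1 hf). Qed.

Lemma expandsMn g p : expands g -> expands (p%:Z *: g).
Proof.
move=> kg; elim: p => [|p IH]; first by rewrite scale0r; apply: expands0.
by rewrite intS scalerDl scale1r; apply: expandsD.
Qed.

Lemma expands_sum h : (forall i, expands (h i 0 *: bas i)) -> expands h.
Proof.
move=> kb; rewrite [h]lattice_sum_bas.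
by elim/big_ind: _ => //; [apply: expands0 | apply: expandsD].
Qed.

Lemma expands_ge0 h : (forall i, expands (bas i)) -> (forall i, 0 <= h i 0) -> expands h.
Proof.
move=> kb h0; apply: expands_sum => i; case: (h i 0) (h0 i) => // p _.
exact: expandsMn.
Qed.

End Closure.
End Hom.

Lemma mon_mulP t g h x y : x = X t g -> y = X t h ->
  vp Q (- form (La t) g h) *: (x * y) = X t (g + h).
Proof. by move=> -> ->; rewrite monD. Qed.

(* Pointed and supported on the line [g + Z ydeg t k]. *)
Definition pt_line t k g (z : A t) := pt g z /\ homog (wt t (predC1 k)) (wt t (predC1 k) g) z.

Lemma pt_lineM t k g h (x y : A t) : pt_line k g x -> pt_line k h y ->
  pt_line k (g + h) (vp Q (- form (La t) g h) *: (x * y)).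
Proof.
move=> [px hx] [py hy]; split; first exact: ptM.
by rewrite wtD; apply: homogZ; apply: homogM => // *; apply: wtD.
Qed.

Lemma pt_lineX t k g : pt_line k g (X t g).
Proof. by split; [apply: ptX | apply: homog_mon]. Qed.

(* [f] is the mutation isomorphism at [k] from the seed [t'] to its neighbour [t]. *)
Record mutmap t t' k (f : F t' -> F t) : Prop := MutMap {
  mm_adj : seed_adj t t' k;
  mm_hom : ishom f;
  mm_X : forall i, i != uf k -> f (iF (X t' (bas i))) = iF (X t (bas i));
  mm_Xk : f (iF (X t' (bas (uf k)))) = iF (X t (mneg t k) + X t (mpos t k))
}.

Section MutMap.
Variables (t t' : qseed n m) (k : 'I_n) (f : F t' -> F t).
Hypothesis mm : mutmap k f.
Let adj := mm_adj mm.
Let hf := mm_hom mm.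
Let Eform x y : form (La t) (mutE t k *m x) (mutE t k *m y) = form (La t') x y.
Proof. by rewrite (adj_form adj). Qed.

Lemma mm_mon0 h : h (uf k) 0 = 0 -> f (iF (X t' h)) = iF (X t h).
Proof.
move=> h0; have PM g g' x y := @mon_mulP t g g' x y.
suff [z -> /= ->] : expands f (mutE t k) (fun g z => z = X t g) h by rewrite mutE_id.
apply: (expands_sum hf Eform) => // [|i]; first by rewrite mon0.
have [->|ik] := eqVneq i (uf k).
  by rewrite h0 scale0r; apply: expands0 => //; rewrite mon0.
have bi : bas i (uf k) 0 = 0 by rewrite basE eq_sym (negbTE ik).
have ki : expands f (mutE t k) (fun g z => z = X t g) (bas i).
  by exists (X t (bas i)); [apply: (mm_X mm) | rewrite /= mutE_id].
case: (h i 0) => p; first by apply: (expandsMn hf Eform) => //; rewrite mon0.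
rewrite NegzE scaleNr -scalerN; apply: (expandsMn hf Eform) => //; first by rewrite mon0.
exists (X t (- bas i)); last by rewrite /= mutE_id // mxE bi oppr0.
have X1 s : X s (- bas i) * X s (bas i) = 1.
  by rewrite monM formNl formxx oppr0 vp0 scale1r addNr mon0.
apply: (@frac_mulIr t (iF (X t (bas i)))); first exact/iF_neq0/mon_neq0.
by rewrite -rmorphM X1 -(mm_X mm) // -(homM hf) -rmorphM X1 !rmorph1 (hom1 hf).
Qed.

Lemma mm_mon1 h : h (uf k) 0 = 1 ->
  f (iF (X t' h)) = iF (X t (mutE t k *m h) + X t (mutE t k *m h + ydeg t k)).
Proof.
move=> h1; have [h0 h00 ->] : exists2 h0 : lattice, h0 (uf k) 0 = 0 & h = h0 + bas (uf k).
  by exists (h - bas (uf k)); rewrite ?subrK // mxE mxE basE eqxx h1 subrr.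
rewrite monD -Eform !mulmxDr mutE_bas mut_basE eqxx !(mutE_id t h00).
have -> : X t (h0 + mneg t k) + X t (h0 + mneg t k + ydeg t k) =
    vp Q (- form (La t) h0 (mneg t k)) *: (X t h0 * (X t (mneg t k) + X t (mpos t k))).
  rewrite mulrDr scalerDr -monD; congr (_ + _).
  have -> : form (La t) h0 (mneg t k) = form (La t) h0 (mpos t k).
    rewrite mposE formDr [form _ h0 (ydeg t k)]formC form_ydeg h00.
    by rewrite mulr0 oppr0 addr0.
  by rewrite -monD mposE -addrA.
by apply: exp_Z => //; apply: exp_M => //; [apply: mm_mon0 | apply: (mm_Xk mm)].
Qed.

(** A nonnegative exponent of [X_k] yields a monomial times a power of the exchange binomial, which
    stays Laurent and lies on one line. *)
Lemma mm_mon_ge0 h : 0 <= h (uf k) 0 ->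
  exists2 z, f (iF (X t' h)) = iF z & pt_line k (mutE t k *m h) z.
Proof.
move=> hk; pose h0 := h - h (uf k) 0 *: bas (uf k).
have h00 : h0 (uf k) 0 = 0.
  by rewrite mxE mxE [X in _ - X]mxE basE eqxx mulr1 subrr.
have PM g g' x y := @pt_lineM t k g g' x y.
have P1 : pt_line k 0 (1 : A t) by rewrite -(mon0 Q t); apply: pt_lineX.
rewrite -[h](subrK (h (uf k) 0 *: bas (uf k))) -/h0.
apply: (expandsD hf Eform) => //.
  by exists (X t h0); [apply: mm_mon0 | rewrite mutE_id //; apply: pt_lineX].
case: (h (uf k) 0) hk => // p _; apply: (expandsMn hf Eform) => //.
rewrite /expands (mm_Xk mm) mutE_bas mut_basE eqxx; eexists; first by [].
split; last first.
  move=> g; rewrite coefD; case: (eqVneq (coef (X t (mneg t k)) g) 0) => [->|/eqP/supp_mon ->//].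
  by rewrite add0r => /supp_mon ->; rewrite mposE wtD wt_ydegC addr0.
split.
  rewrite coefD coef_monX coef_mon mposE; case: eqP => [e|_]; last by rewrite addr0.
  have := wt_ydeg t k; have : ydeg t k = 0 by apply: (addrI (mneg t k)); rewrite e addr0.
  by move=> ->; rewrite /wt form0l; move: (diagD_gt0 t k); lia.
move=> g; rewrite coefD; case: (eqVneq (coef (X t (mneg t k)) g) 0) => [->|/eqP/supp_mon -> _].
  rewrite add0r => /supp_mon ->; exists (delta_mx k 0); rewrite -ydegE mposE.
  by split=> // i; rewrite mxE; case: (_ && _).
exact: dom_refl.
Qed.

End MutMap.
End Fields.

Section MutMapInverse.
Variables (n m : nat) (Q : quantum_tori n m).
Variable F : forall t, skew_field_of_fractions (alg Q t).
Local Notation uf := (@lshift n m).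
Local Notation lattice := ('cV[int]_(n + m)).
Local Notation A := (alg Q).
Local Notation X := (mon Q).
Local Notation iF z := (sf_in (F _) z).
Implicit Types (t b r : qseed n m) (g h : lattice) (k : 'I_n).

Lemma ydeg_neq0 t k : ydeg t k <> 0.
Proof. by move=> e; move: (wt_ydeg t k) (diagD_gt0 t k); rewrite e /wt form0l; lia. Qed.

Lemma spread_binomial t k g :
  spread (wt t (pred1 k)) (diagD t k) (X t g + X t (g + ydeg t k)).
Proof.
have ne : g + ydeg t k <> g by move=> e; apply/(@ydeg_neq0 t k)/(addrI g); rewrite addr0.
exists g, (g + ydeg t k); split; last by rewrite wtD wt_ydeg; lia.
  by rewrite coefD coef_monX coef_mon; case: eqP => // _; rewrite addr0; apply: scal1_neq0.
rewrite coefD coef_monX coef_mon; case: eqP => [/esym//|_].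
by rewrite add0r; apply: scal1_neq0.
Qed.

Lemma mutmap_sym t t' k (f : F t' -> F t) (g : F t -> F t') :
  mutmap k f -> cancel f g -> cancel g f -> mutmap k g.
Proof.
move=> mm fK gK; have adj := mm_adj mm; have hf := mm_hom mm.
split=> [||i ik|]; first exact: seed_adj_sym.
- exact: ishom_inv hf fK gK.
- by rewrite -(mm_X mm ik) fK.
apply: (can_inj fK); rewrite gK.
set V := X t (mneg t k) + X t (mpos t k).
have V0 : V <> 0.
  move=> V0; have [a [b [+ _ _]]] := spread_binomial t k (mneg t k).
  by rewrite -mposE -/V V0 coef0.
(* After multiplication by [V], the image of [X_k(t')], both sides are exchange binomials; their
   monomials do not involve [k], so [f] fixes them. *)
apply: (frac_mulI (iF_neq0 V0)); rewrite -{2}(mm_Xk mm) -(homM hf) -!rmorphM.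
rewrite mulrDl mulrDr !monM /mneg /mpos !addrA subrr add0r.
rewrite ![_ + _ + bas _]addrAC !addNr !add0r.
rewrite (adj_xneg adj) (adj_xpos adj) [in LHS]addrC; apply/esym.
have fm h : h (uf k) 0 = 0 -> form (La t') (bas (uf k)) h = form (La t) (mneg t k) h.
  by move=> h0; rewrite (adj_form adj) mutE_bas mut_basE eqxx mutE_id.
have np : form (La t) (xneg t k) (xpos t k) = 0.
  rewrite xposE formDr formxx formC form_ydeg xneg_k; lia.
have -> : form (La t') (bas (uf k)) (- bas (uf k) + xpos t k)
    = form (La t) (- bas (uf k) + xpos t k) (bas (uf k)).
  rewrite formDr formNr formxx fm ?xpos_k // !formDl !formNl formxx np.
  by rewrite [form _ (xpos t k) _]formC; lia.
have -> : form (La t') (bas (uf k)) (- bas (uf k) + xneg t k)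
    = form (La t) (- bas (uf k) + xneg t k) (bas (uf k)).
  rewrite formDr formNr formxx fm ?xneg_k // !formDl !formNl !formxx.
  by rewrite [form _ (xneg t k) _]formC; lia.
by apply: exp_D => //; apply: exp_Z => //; apply: (mm_mon0 mm); rewrite ?xpos_k ?xneg_k.
Qed.

Lemma hom_eq_mon r b (f1 f2 : F r -> F b) : ishom f1 -> ishom f2 ->
  (forall i, f1 (iF (X r (bas i))) = f2 (iF (X r (bas i)))) -> f1 =1 f2.
Proof.
move=> h1 h2 e.
pose S h := f1 (iF (X r h)) = f2 (iF (X r h)).
have S0 : S 0 by rewrite /S mon0 !rmorph1 (hom1 h1) (hom1 h2).
have SD g h : S g -> S h -> S (g + h).
  rewrite /S => eg eh; rewrite monD -mulr_algl !rmorphM.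
  by rewrite !(homM h1) !(homM h2) (homS h1) (homS h2) eg eh.
have SN g : S g -> S (- g).
  rewrite /S => eg; apply: (@frac_mulIr _ _ _ F _ (f1 (iF (X r g)))).
    by move=> /(hom_eq0 h1); apply/iF_neq0/mon_neq0.
  have X1 : X r (- g) * X r g = 1.
    by rewrite monM formNl formxx oppr0 vp0 scale1r addNr mon0.
  by rewrite {2}eg -(homM h1) -(homM h2) -rmorphM X1 rmorph1 (hom1 h1) (hom1 h2).
have Sall h : S h.
  rewrite [h]lattice_sum_bas; elim/big_ind: _ => // i _.
  have Sp p : S (p%:Z *: bas i).
    by elim: p => [|p IH]; rewrite ?scale0r // intS scalerDl scale1r; apply: SD.
  by case: (h i 0) => p //; rewrite NegzE scaleNr; apply: SN.
have Sz (z : A r) : f1 (iF z) = f2 (iF z).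
  rewrite (alg_sum z); elim/big_ind: _ => [|x y ex ey|h _].
  - by rewrite rmorph0 (hom0 h1) (hom0 h2).
  - by rewrite rmorphD (homD h1) (homD h2) ex ey.
  by rewrite -mulr_algl rmorphM (homM h1) (homM h2) (homS h1) (homS h2) (Sall h).
move=> x; have [y [z [z0 ->]]] := sf_frac x.
have zu : sf_in (F r) z \is a GRing.unit.
  by apply: sf_unit; apply/eqP/iF_neq0/eqP.
apply: (@frac_mulIr _ _ _ F _ (f1 (iF z))).
  by move=> /(hom_eq0 h1) e0; rewrite e0 unitr0 in zu.
by rewrite {2}Sz -(homM h1) -(homM h2) divrK.
Qed.

Lemma mutmap_uniq t t' k (f1 f2 : F t' -> F t) : mutmap k f1 -> mutmap k f2 -> f1 =1 f2.
Proof.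
move=> m1 m2; apply: (hom_eq_mon (mm_hom m1) (mm_hom m2)) => i.
by have [->|ik] := eqVneq i (uf k); rewrite ?(mm_Xk m1) ?(mm_Xk m2) // (mm_X m1 ik) (mm_X m2 ik).
Qed.

Section Graded.
Variables (t t' : qseed n m) (k : 'I_n) (f : F t' -> F t).
Hypothesis mm : mutmap k f.
Let hf := mm_hom mm.
Local Notation W s := (wt s (predC1 k)).

Let graded (y' : A t') := exists2 y, f (iF y') = iF y &
  forall c, f (iF (gcomp (W t') c y')) = iF (gcomp (W t) c y).

Let graded_ge0 (y' : A t') : (forall h, coef y' h <> 0 -> 0 <= h (uf k) 0) -> graded y'.
Proof.
move=> y'0; rewrite (alg_sum y'); elim/big_ind: _ => [|x1 x2|h _].
- by exists 0 => [|c]; rewrite ?gcomp0 !rmorph0 (hom0 hf).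
- move=> [y1 e1 c1] [y2 e2 c2]; exists (y1 + y2) => [|c]; first exact: exp_D.
  by rewrite !gcompD; apply: exp_D.
have [->|/eqP /y'0 hk] := eqVneq (coef y' h) 0.
  by exists 0 => [|c]; rewrite scale0r ?gcomp0 !rmorph0 (hom0 hf).
have [z ez [_ hz]] := mm_mon_ge0 mm hk.
exists (coef y' h *: z) => [|c]; first exact: exp_Z.
rewrite !gcompZ; apply: exp_Z => //.
have hX := @homog_mon _ _ Q t' (W t') h.
have eW : W t' h = W t (mutE t k *m h) by apply: adj_wt; apply: mm_adj mm.
rewrite eW in hX; have [ce|/eqP ce] := eqVneq (W t (mutE t k *m h)) c.
  by rewrite -ce !gcomp_id.
by rewrite !(gcomp_ne (c := W t (mutE t k *m h))) // !rmorph0 (hom0 hf).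
Qed.

(** Monomials with nonnegative exponent at [k] have homogeneous images of the same weight. The
    general case follows by multiplying with a homogeneous power of [X_k(t')] and cancelling its
    image. *)
Lemma mm_gcomp (z : A t) (z' : A t') c : f (iF z') = iF z ->
  f (iF (gcomp (W t') c z')) = iF (gcomp (W t) c z).
Proof.
move=> ez; have [p hp] : exists p : nat, forall h, coef z' h <> 0 -> 0 <= h (uf k) 0 + p%:Z.
  have [p hp] : exists p : nat, forall h, h \in supp z' -> 0 <= h (uf k) 0 + p%:Z.
    elim: (supp z') => [|h l [p IH]]; first by exists 0%N.
    exists (p + `|h (uf k) 0%R|)%N => h'; rewrite inE => /orP[/eqP->|/IH]; lia.
  by exists p => h hz; apply: hp; apply: contraPT hz => /coef_out ->.
(* [X t' e] removes the negative powers of [X_k(t')], whose images need not be Laurent one by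
   one. *)
pose e := p%:Z *: bas (uf k) : lattice.
have ek : e (uf k) 0 = p%:Z by rewrite mxE basE eqxx mulr1.
have [T eT [pT hT]] : exists2 T, f (iF (X t' e)) = iF T & pt_line k (mutE t k *m e) T.
  by apply: (mm_mon_ge0 mm); rewrite ek.
have [|y ey cy] := @graded_ge0 (z' * X t' e).
  by move=> h /suppM[a [b [/hp az /supp_mon -> ->]]]; rewrite mxE ek.
have {ey} ey : y = z * T.
  by apply: (@sf_in_inj _ (F t)); rewrite -ey rmorphM (homM hf) ez eT -rmorphM.
have eW : W t (mutE t k *m e) = W t' e by rewrite -(adj_wt e (mm_adj mm)).
have := cy (c + W t' e); rewrite ey (gcomp_homogMr (@wtD _ _ _ _)); last exact: homog_mon.
rewrite (gcomp_homogMr (@wtD _ _ _ _)); last by rewrite -eW.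
rewrite !rmorphM (homM hf) eT; apply: frac_mulIr; apply: iF_neq0.
exact: pt_neq0 pT.
Qed.

(* Otherwise the binomial [X_k(t)] would divide a monomial at [t']. *)
Lemma mm_laurent (g : F t -> F t') (z' : A t') h : cancel f g -> cancel g f ->
  f (iF z') = iF (X t h) -> 0 <= h (uf k) 0.
Proof.
move=> fK gK ez; rewrite leNgt; apply/negP => hk.
have mg := mutmap_sym mm fK gK; have hg := mm_hom mg.
have [p ep] : exists p : nat, h (uf k) 0 = - p.+1%:Z.
  by exists (`|h (uf k) 0%R|%N.-1); lia.
have [z2 e2 [p2 _]] : exists2 z2, g (iF (X t (p%:Z *: bas (uf k)))) = iF z2 &
    pt_line k (mutE t' k *m (p%:Z *: bas (uf k))) z2.
  by apply: (mm_mon_ge0 mg); rewrite mxE basE eqxx mulr1.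
pose V := X t' (mneg t' k) + X t' (mpos t' k).
have [h0 [c e0 h00]] : exists h0, exists2 c, X t h * X t (p%:Z *: bas (uf k)) * X t (bas (uf k))
    = vp Q c *: X t h0 & h0 (uf k) 0 = 0.
  rewrite monM -scalerAl monM scalerA -vpD; eexists; eexists; first by [].
  by rewrite !mxE !eqxx ep !mulr1; lia.
have eV : z' * z2 * V = vp Q c *: X t' h0.
  apply: (@sf_in_inj _ (F t')); rewrite !rmorphM -(mm_Xk mg) -e2 -[sf_in _ z']fK ez.
  by rewrite -!(homM hg) -!rmorphM e0; apply: exp_Z => //; apply: (mm_mon0 mg).
have zV : z' * z2 <> 0.
  move=> e; move: eV; rewrite e mul0r => /(congr1 (fun x => vp Q (- c) *: x)).
  by rewrite scalevK scaler0 => /esym; apply: mon_neq0.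
have wD := @wtD _ _ t' (pred1 k).
have := spreadM (alg_dom F (t := t')) wD (spread0 (wt t' (pred1 k)) zV)
  (spread_binomial t' k (mneg t' k)).
have hX : homog (wt t' (pred1 k)) (wt t' (pred1 k) h0) (vp Q c *: X t' h0).
  by apply: homogZ; apply: homog_mon.
rewrite -mposE -/V eV => /(homog_spread hX).
by move: (diagD_gt0 t' k); lia.
Qed.

End Graded.
End MutMapInverse.

(** * Cluster variables seen from a fixed seed *)

Section Routes.
Variables (n m : nat) (Q : quantum_tori n m).
Variable F : forall t, skew_field_of_fractions (alg Q t).
Local Notation uf := (@lshift n m).
Local Notation lattice := ('cV[int]_(n + m)).
Local Notation A := (alg Q).
Local Notation X := (mon Q).
Local Notation iF z := (sf_in (F _) z).
Implicit Types (t b r : qseed n m) (g h : lattice) (k : 'I_n).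

Variable mst : forall t k, F (mu t k) -> F t.
Variable mst_inv : forall t k, F t -> F (mu t k).
Hypothesis mstP : forall t k, mutmap k (@mst t k).
Hypothesis mstK : forall t k, cancel (@mst t k) (@mst_inv t k).
Hypothesis mst_invK : forall t k, cancel (@mst_inv t k) (@mst t k).

(* The isomorphisms [F r -> F b] induced by mutation sequences from [b] to [r]. *)
Inductive route b : forall r, (F r -> F b) -> Prop :=
| RouteId (f : F b -> F b) of (forall x, f x = x) : route f
| RouteMut r k (f : F r -> F b) (f' : F (mu r k) -> F b) of
    route f & (forall x, f' x = f (mst x)) : route f'.

Lemma route_ext b r (f g : F r -> F b) : route f -> (forall x, g x = f x) -> route g.
Proof.
move=> rf; case: r f / rf g => [f ef g eg|r k f f' rf ef' g eg].
  by apply: RouteId => x; rewrite eg.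
by apply: (RouteMut rf) => x; rewrite eg.
Qed.

Lemma route_trans b c r (f : F r -> F c) (g : F c -> F b) :
  route f -> route g -> route (fun x => g (f x)).
Proof.
move=> rf; elim: r f / rf => [f ef|r k f f' _ IH ef'] rg.
  by apply: (route_ext rg) => x; rewrite ef.
by apply: (RouteMut (IH rg)) => x; rewrite ef'.
Qed.

Lemma route_mst t k : route (@mst t k).
Proof. by apply: (@RouteMut _ _ _ (fun x => x)) => //; apply: RouteId. Qed.

Lemma mutmap_mst_inv t k : mutmap k (@mst_inv t k).
Proof. exact: mutmap_sym (mstP t k) (@mstK t k) (@mst_invK t k). Qed.

(** The inverse mutation satisfies the equations of the mutation map from [mu (mu t k) k], so
    uniqueness identifies the two. *)
Lemma route_mst_inv t k : route (@mst_inv t k).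
Proof.
(* Replacing [t] by a variable [s] allows case analysis on the equality of seeds. *)
have H s : mu (mu t k) k = s -> forall f : F s -> F (mu t k), mutmap k f -> route f.
  move=> e; case: s / e => f mf.
  apply: (@RouteMut _ _ _ (fun x => x)); first exact: RouteId.
  exact: mutmap_uniq mf (mstP _ _).
exact: H (mu_invol t k) _ (mutmap_mst_inv t k).
Qed.

Lemma route_ishom b r (f : F r -> F b) : route f -> ishom f.
Proof.
move=> rf; elim: r f / rf => [f ef|r k f f' _ IH ef'].
  by split=> *; rewrite !ef.
have h := ishom_comp IH (mm_hom (mstP r k)).
by split=> *; rewrite !ef' ?(homD h) ?(homM h) ?(hom1 h) ?(homS h).
Qed.

Lemma route_diagD b r (f : F r -> F b) j : route f -> diagD r j = diagD b j.
Proof.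
move=> rf; elim: r f / rf => [//|r k f f' _ IH _].
by rewrite (adj_diagD (seed_adj_mu r k)).
Qed.

Variable D : qseed n m -> Prop.
Hypothesis Dmu : forall t k, D t -> D (mu t k).
Hypothesis Dpt : forall b, D b -> forall r (f : F r -> F b), route f ->
  forall i, exists g, exists2 z, f (iF (X r (bas i))) = iF z & pt g z.

(* The columns of [G] are the degrees at [b] of the cluster variables of [r]. *)
Definition gmat b r (f : F r -> F b) (G : 'M[int]_(n + m)) :=
  forall i, expands f G (fun g z => pt g z) (bas i).

Lemma gmat_exists b r (f : F r -> F b) : D b -> route f -> exists G, gmat f G.
Proof.
move=> Db rf; have [g gP] := fin_all_exists (Dpt Db rf).
exists (\matrix_(i, j) g j i 0) => i; have [z ez pz] := gP i; exists z => //.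
rewrite mulmx_bas; suff -> : col i (\matrix_(i, j) g j i 0) = g i by [].
by apply/matrixP => a c; rewrite !mxE ord1.
Qed.

Section Gmat.
Variables (b r : qseed n m) (f : F r -> F b) (G : 'M[int]_(n + m)).
Hypotheses (Db : D b) (rf : route f) (gm : gmat f G).
Let hf := route_ishom rf.

Lemma vp_neq0 c : vp Q c <> 0.
Proof. by move=> e; have := vpK Q c; rewrite e mulr0 => /esym; apply: scal1_neq0. Qed.

(** Variables of [r] commute up to a power of [v]; the exponent can be read on leading terms because
    the powers of [v] are distinct. *)
Lemma gmat_form x y : form (La b) (G *m x) (G *m y) = form (La r) x y.
Proof.
suff -> : La r = G^T *m La b *m G by rewrite /form trmx_mul !mulmxA.
apply/matrixP => i j.
have -> : (G^T *m La b *m G) i j = form (La b) (G *m bas i) (G *m bas j).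
  rewrite /form !trmx_mul trmx_delta -!mulmxA -rowE !mulmxA -colE.
  by rewrite [RHS]mxE [RHS]mxE.
have [zi ei [ci di]] := gm i; have [zj ej [cj dj]] := gm j.
have e : zi * zj = vp Q (La r i j - La r j i) *: (zj * zi).
  apply: (@sf_in_inj _ (F b)); rewrite -(exp_M hf ei ej).
  rewrite -(exp_Z hf _ (exp_M hf ej ei)); congr (f (iF _)).
  by rewrite !monM !form_bas scalerA -vpD subrK [bas j + _]addrC.
have := congr1 (fun u => coef u (G *m bas i + G *m bas j)) e.
rewrite coefZ (coef_domM di dj) [G *m bas i + _]addrC (coef_domM dj di).
rewrite ci cj !mulr1 -vpD => /vp_inj.
rewrite [form _ (G *m bas j) _]formC -!form_bas [form (La r) (bas j) _]formC; lia.
Qed.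

Lemma gmat_ge0 h : (forall i, 0 <= h i 0) -> expands f G (fun g z => pt g z) h.
Proof.
apply: (expands_ge0 hf gmat_form) gm; first by move=> *; apply: ptM.
by rewrite -(mon0 Q b); apply: ptX.
Qed.

Lemma exchange j (x x' zp zq : A b) :
  f (iF (X r (bas (uf j)))) = iF x ->
  f (mst (iF (X (mu r j) (bas (uf j))))) = iF x' ->
  f (iF (X r (xneg r j))) = iF zp -> f (iF (X r (xpos r j))) = iF zq ->
  x * x' = vp Q (form (La r) (bas (uf j)) (mneg r j)) *: zp
         + vp Q (form (La r) (bas (uf j)) (mpos r j)) *: zq.
Proof.
move=> ex ex' ep eq; apply: (@sf_in_inj _ (F b)).
rewrite rmorphM -ex -ex' (mm_Xk (mstP r j)) -(homM hf) -rmorphM mulrDr !monM.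
have bE y : bas (uf j) + (- bas (uf j) + y) = y by rewrite addrA subrr add0r.
by apply: exp_D => //; apply: exp_Z => //; rewrite bE.
Qed.

(** In the exchange relation the product has a greatest degree [e], and the two terms have greatest
    degrees differing by [G *m ydeg r j]. If neither term dominated the other, both degrees would
    survive below [e], while one of them dominates [e]. *)
Lemma cmat_exists : exists C : 'M[int]_n, G *m Bt r = Bt b *m C /\
  forall j, (forall i, 0 <= C i j) \/ (forall i, C i j <= 0).
Proof.
suff /fin_all_exists[c cP] j : exists c : 'cV[int]_n, G *m ydeg r j = Bt b *m c /\
    ((forall i, 0 <= c i 0) \/ (forall i, c i 0 <= 0)).
  exists (\matrix_(i, j) c j i 0).
  have cE j : col j (\matrix_(i, j) c j i 0) = c j.
    by apply/matrixP => i l; rewrite !mxE ord1.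
  split=> [|j].
    apply/matrixP => i j; move: (cP j).1; rewrite -cE ydegE !colE !mulmxA -!colE.
    by move/matrixP => /(_ i 0); rewrite [LHS]mxE [RHS]mxE.
  by have [_ [H|H]] := cP j; [left|right] => i; rewrite mxE.
have [x ex [cx dx]] := gm (uf j).
have [g' [x' ex' [cx' dx']]] := Dpt Db (RouteMut (k := j) rf (fun _ => erefl)) (uf j).
have [zp ep [cp dp]] := gmat_ge0 (xneg_ge0 r j).
have [zq eq [cq dq]] := gmat_ge0 (xpos_ge0 r j).
have E := exchange ex ex' ep eq.
set al := vp Q _ in E; set be := vp Q _ in E.
set e := G *m bas (uf j) + g'.
have de h : coef (x * x') h <> 0 -> dom b e h by apply: supp_domM.
have ne : coef (x * x') e <> 0.
  by rewrite (coef_domM dx dx') cx cx' !mulr1; apply: vp_neq0.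
have He : dom b (G *m xneg r j) e \/ dom b (G *m xpos r j) e.
  move: ne; rewrite E coefD !coefZ => ne.
  have [e0|/eqP/dp] := eqVneq (coef zp e) 0; last by left.
  by right; apply: dq => e1; apply: ne; rewrite e0 e1 !mulr0 addr0.
have Hp : dom b e (G *m xneg r j) \/ dom b (G *m xpos r j) (G *m xneg r j).
  have [e0|/eqP/dq] := eqVneq (coef zq (G *m xneg r j)) 0; last by right.
  left; apply: de; rewrite E coefD !coefZ cp e0 mulr0 addr0 mulr1; exact: vp_neq0.
have Hq : dom b e (G *m xpos r j) \/ dom b (G *m xneg r j) (G *m xpos r j).
  have [e0|/eqP/dp] := eqVneq (coef zp (G *m xpos r j)) 0; last by right.
  left; apply: de; rewrite E coefD !coefZ cq e0 mulr0 add0r mulr1; exact: vp_neq0.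
have eGq : G *m xpos r j = G *m xneg r j + G *m ydeg r j by rewrite xposE mulmxDr.
have [[a [a0 ea]]|[a [a0 ea]]] : dom b (G *m xneg r j) (G *m xpos r j) \/
    dom b (G *m xpos r j) (G *m xneg r j).
  case: Hp => [Hp|]; last by right.
  case: Hq => [Hq|]; last by left.
  by case: He => He; [left; apply: dom_trans Hq|right; apply: dom_trans Hp].
- by exists a; split; [apply: (addrI (G *m xneg r j)); rewrite -eGq | left].
exists (- a); split; last by right => i; rewrite mxE oppr_le0.
rewrite mulmxN; apply: (addrI (G *m xneg r j)); rewrite -eGq.
by apply: (addIr (Bt b *m a)); rewrite -ea subrK.
Qed.

Variable C : 'M[int]_n.
Hypothesis eC : G *m Bt r = Bt b *m C.

Lemma cmat_ydeg j : G *m ydeg r j = Bt b *m col j C.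
Proof. by rewrite ydegE mulmxA eC colE mulmxA. Qed.

(** Pair the degrees of [Y_j] and of the variable [i], at [r] and at [b], using that [diagD] is
    invariant along routes. *)
Lemma gmat_dual j i :
  \sum_l diagD b l * C l j * G (uf l) i = diagD b j * (i == uf j)%:R.
Proof.
have := gmat_form (ydeg r j) (bas i).
rewrite form_ydeg (route_diagD j rf) basE eq_sym => <-.
rewrite cmat_ydeg form_Bt mulmx_bas; apply: eq_bigr => l _.
by rewrite !mxE.
Qed.

Lemma cmat_unit : C \in unitmx /\ ulsubmx G \in unitmx.
Proof.
pose d : 'rV[int]_n := \row_j diagD b j.
have e : C^T *m diag_mx d *m ulsubmx G = diag_mx d.
  apply/matrixP => j i; rewrite -mulmxA mxE [RHS]mxE.
  under eq_bigr do rewrite mul_diag_mx !mxE mulrA [C _ _ * _]mulrC.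
  rewrite gmat_dual !mxE (inj_eq (@lshift_inj _ _)) eq_sym.
  by case: eqP => [->|]; rewrite ?mulr1 ?mulr0.
have d0 : \det (diag_mx d) != 0.
  rewrite det_diag; apply/prodf_neq0 => j _; rewrite mxE; exact/lt0r_neq0/diagD_gt0.
have u : \det C * \det (ulsubmx G) = 1.
  apply: (mulIf d0); rewrite mul1r mulrAC -{2}e !det_mulmx det_tr.
  by [].
by rewrite !unitmxE; split; apply/unitrPr; eexists; [apply: u | rewrite mulrC; apply: u].
Qed.

Lemma cmat_col_unit j k : (forall l, l != k -> C l j = 0) -> C k j = 1 \/ C k j = -1.
Proof.
move=> H; have [uC _] := cmat_unit.
have e : col j C = C k j *: delta_mx k 0.
  apply/matrixP => i l; rewrite !mxE ord1 eqxx andbT.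
  by case: eqVneq => [->|/H ->]; rewrite ?mulr1 ?mulr0.
have : (C k j *: (invmx C *m (delta_mx k 0 : 'cV_n))) j 0 = 1.
  by rewrite scalemxAr -e colE mulKmx // mxE !eqxx.
rewrite mxE; move: (C k j) ((invmx C *m _) j 0) => u v uv.
have : u \is a GRing.unit by apply/unitrPr; exists v.
by case/orP => /eqP ->; [left|right].
Qed.

Lemma gmat_row_unit j k : (forall i, i != j -> G (uf k) (uf i) = 0) ->
  G (uf k) (uf j) = 1 \/ G (uf k) (uf j) = -1.
Proof.
move=> H; have [_ uG] := cmat_unit.
have e : row k (ulsubmx G) = G (uf k) (uf j) *: delta_mx 0 j.
  apply/matrixP => l i; rewrite !mxE ord1 eqxx.
  by case: eqVneq => [->|/H ->]; rewrite ?mulr1 ?mulr0.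
have : (G (uf k) (uf j) *: ((delta_mx 0 j : 'rV_n) *m invmx (ulsubmx G))) 0 k = 1.
  by rewrite scalemxAl -e rowE mulmxK // mxE !eqxx.
rewrite mxE; move: (G (uf k) (uf j)) ((_ *m invmx _) 0 k) => u v uv.
have : u \is a GRing.unit by apply/unitrPr; exists v.
by case/orP => /eqP ->; [left|right].
Qed.

End Gmat.

(** * Transformation of the degrees of cluster variables by [phi] *)

Local Notation W b k := (wt b (predC1 k)).

(** On this half-space [phi] is the linear base change from [t] to [t']. *)
Lemma phi_ge0 t t' k g : seed_adj t t' k -> 0 <= g (uf k) 0 -> phi t k g = mutE t' k *m g.
Proof.
move=> adj g0; rewrite mutEE /mneg (adj_xneg adj); apply/matrixP => i j.
rewrite !mxE !ord1 g0 !eqxx; case: eqVneq => [->|ik] /=; last by ring.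
by rewrite Btkk [pos 0]maxxx; ring.
Qed.

Lemma phi_invol t t' k g : seed_adj t t' k -> phi t' k (phi t k g) = g.
Proof.
move=> adj; apply/matrixP => i j; rewrite !mxE !ord1 !eqxx (adj_Bt_k adj) opprK.
case: eqVneq => [->//|_]; rewrite opprK.
move: (pos _) (pos _) (g _ 0) (g i 0) => p q x y.
case: leP => h1; case: leP => h2; try by ring.
  by have -> : x = 0 by [lia]; ring.
by move: h1 h2; lia.
Qed.

(* The terms of [z] on the line [g + Z ydeg b k] through its degree reduce to one
   monomial: the F-polynomial of [z], restricted to [Y_k], is trivial. *)
Definition low_mon b k g (z : A b) := pt g z /\ gcomp (W b k) (W b k g) z = X b g.

Lemma low_monM b k g h (x y : A b) : low_mon k g x -> low_mon k h y ->
  low_mon k (g + h) (vp Q (- form (La b) g h) *: (x * y)).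
Proof.
move=> [px lx] [py ly]; split; first exact: ptM.
rewrite gcompZ wtD (gcomp_lowM (@wtD _ _ _ _)); try exact: pt_lowb.
by rewrite lx ly -monD.
Qed.

Lemma low_mon1 b k : low_mon k 0 (1 : A b).
Proof.
rewrite -(mon0 Q b); split; first exact: ptX.
by rewrite gcomp_id // => h /supp_mon ->.
Qed.

Lemma low_mon_pt b k g (z : A b) h : pt g z -> gcomp (W b k) (W b k g) z = X b h ->
  h = g /\ low_mon k g z.
Proof.
move=> pz e; have [c _] := pt_gcomp (predC1 k) pz.
suff eg : h = g by split=> //; split=> //; rewrite e eg.
by apply/esym; apply: (@supp_mon _ _ Q b); rewrite -e c; apply: scal1_neq0.
Qed.

Lemma min_weight_uniq b (w : lattice -> int) c c' (z : A b) :
  lowb w c z -> gcomp w c z <> 0 -> lowb w c' z -> gcomp w c' z <> 0 -> c = c'.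
Proof.
move=> l1 n1 l2 n2; have [cc|cc|//] := ltgtP c c'.
  by case: n1; apply: gcomp_lt l2 cc.
by case: n2; apply: gcomp_lt l1 cc.
Qed.

(** [mu_] respects the grading, hence matches the lowest components of [z'] and of [z]. *)
Lemma mm_transfer b b' k (mu_ : F b' -> F b) g g' (z : A b) (z' u' : A b') :
  mutmap k mu_ -> pt g z -> pt g' z' -> mu_ (iF z') = iF z ->
  mu_ (iF u') = iF (gcomp (W b k) (W b k g) z) -> gcomp (W b' k) (W b' k g') z' = u'.
Proof.
move=> mm pz pz' ez eu; have hm := mm_hom mm.
have eg c := mm_gcomp mm c ez.
have -> : W b' k g' = W b k g.
  have [lt|lt|//] := ltgtP (W b' k g') (W b k g).
    have := eg (W b' k g'); rewrite (gcomp_lt (pt_lowb _ pz) lt) rmorph0 => /(hom_eq0 hm).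
    by move/iF_neq0 => []; apply: (pt_neq0 (pt_gcomp _ pz')).
  have := eg (W b k g); rewrite (gcomp_lt (pt_lowb _ pz') lt) rmorph0 (hom0 hm) => /esym.
  by move/iF_neq0 => []; apply: (pt_neq0 (pt_gcomp _ pz)).
by apply: (@sf_in_inj _ (F b')); apply: (hom_inj hm); rewrite eg eu.
Qed.

Lemma mm_phi b b' k (mu_ : F b' -> F b) (nu_ : F b -> F b') g g' (z : A b) (z' : A b') :
  mutmap k mu_ -> cancel mu_ nu_ -> cancel nu_ mu_ ->
  low_mon k g z -> 0 <= g (uf k) 0 -> pt g' z' -> mu_ (iF z') = iF z -> g' = phi b k g.
Proof.
move=> mm mK nK [pz lz] g0 pz' ez.
have [u eu [pu _]] := mm_mon_ge0 (mutmap_sym mm mK nK) g0.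
have e : gcomp (W b' k) (W b' k g') z' = u.
  by apply: (mm_transfer mm pz pz' ez); rewrite -eu nK lz.
rewrite (phi_ge0 (mm_adj mm) g0); apply: pt_uniq pu.
by rewrite -e; apply: pt_gcomp.
Qed.

(** Row [k] of the matrix of degrees is nonnegative, and no variable of [r] has a nontrivial part in
    the direction of [Y_k] alone. The sign condition is what [mm_phi] requires. *)
Definition Splus b k r (f : F r -> F b) := forall i, exists g,
  exists2 z, f (iF (X r (bas i))) = iF z & low_mon k g z /\ 0 <= g (uf k) 0.

Lemma Splus_ext b k r (f f' : F r -> F b) : (forall x, f' x = f x) ->
  Splus k f -> Splus k f'.
Proof. by move=> e S i; have [g [z ez Hz]] := S i; exists g, z; rewrite ?e. Qed.

Lemma Splus_gmat b k r (f : F r -> F b) : Splus k f -> exists G,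
  (forall i, expands f G (fun g z => low_mon k g z) (bas i)) /\ forall i, 0 <= G (uf k) i.
Proof.
move=> /fin_all_exists[g gP]; exists (\matrix_(i, j) g j i 0); split=> i; last first.
  by rewrite mxE; have [z _ []] := gP i.
have [z ez [pz _]] := gP i; exists z => //.
rewrite mulmx_bas; suff -> : col i (\matrix_(i, j) g j i 0) = g i by [].
by apply/matrixP => a c; rewrite !mxE ord1.
Qed.

Lemma mon_quot b g h g' c (u : A b) : X b g * u = vp Q c *: X b h -> pt g' u -> u = X b g'.
Proof.
move=> e [ug _].
have eu : u = vp Q (c - form (La b) g (h - g)) *: X b (h - g).
  apply: (alg_mulI F (mon_neq0 (t := b) (g := g))); rewrite e -scalerAr monM scalerA -vpD.
  by rewrite subrK addrC subrK.
have eh : g' = h - g.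
  by apply: (@supp_mon _ _ Q b) => c0; move: ug; rewrite eu coefZ c0 mulr0 => /esym;
     apply: scal1_neq0.
by move: ug; rewrite eu coefZ eh coef_monX mulr1 => ->; rewrite scale1r.
Qed.

(** Only the lowest part of the new variable matters. If column [j] of [C] has a nonzero entry
    outside [k], sign-coherence separates the weights of the two exchange terms; one survives and
    the new variable is again low-monomial at [b]. Otherwise the column is the unit vector at [k]
    and both terms survive: they form the binomial of a mutation at [k], a monomial at [b']. The
    other variables then have coordinate 0 at [k] and keep a monomial lowest part at [b']. *)
Lemma Splus_mut b b' k (mu_ : F b' -> F b) (nu_ : F b -> F b') r (f : F r -> F b) j :
  mutmap k mu_ -> cancel mu_ nu_ -> cancel nu_ mu_ -> route nu_ -> D b -> D b' ->
  route f -> Splus k f ->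
  Splus k (fun x => f (mst (k := j) x)) \/ Splus k (fun x => nu_ (f (mst (k := j) x))).
Proof.
move=> mm mK nK rn Db Db' rf S.
have hf := route_ishom rf; have wD P := @wtD _ _ b P.
have rfj : route (fun x => f (mst (k := j) x)) by apply: (RouteMut rf).
have [G [gl G0]] := Splus_gmat S.
have gm : gmat f G by move=> i; have [z ez [pz _]] := gl i; exists z.
have Gf := gmat_form rf gm.
have [C [eC sC]] := cmat_exists Db rf gm.
have same i : i != uf j -> f (mst (iF (X (mu r j) (bas i)))) = f (iF (X r (bas i))).
  by move=> ij; rewrite (mm_X (mstP r j) ij).
have [x ex [px lx]] := gl (uf j).
have [g' [x' ex' px']] := Dpt Db rfj (uf j).
have [g2 [z2 ez2 pz2]] := Dpt Db' (route_trans rfj rn) (uf j).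
have ge0 h : (forall i, 0 <= h i 0) -> expands f G (fun g z => low_mon k g z) h.
  apply: (expands_ge0 hf Gf) gl; [by move=> *; apply: low_monM | exact: low_mon1].
have [zp ep [pp lp]] := ge0 _ (xneg_ge0 r j).
have [zq eq [pq lq]] := ge0 _ (xpos_ge0 r j).
have E := exchange rf ex ex' ep eq.
set al := form _ _ (mneg _ _) in E; set be := form _ _ (mpos _ _) in E.
have eGq : G *m xpos r j = G *m xneg r j + Bt b *m col j C.
  by rewrite xposE mulmxDr (cmat_ydeg eC).
set gx := G *m bas (uf j) in px lx.
set u := gcomp (W b k) (W b k g') x'; have pu : pt g' u by apply: pt_gcomp.
have lowE : gcomp (W b k) (W b k gx + W b k g') (x * x') = X b gx * u.
  by rewrite (gcomp_lowM (wD _)) ?lx //; apply: pt_lowb.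
have lowbE : lowb (W b k) (W b k gx + W b k g') (x * x').
  by apply: (lowbM (wD _)); apply: pt_lowb.
have lowE0 : X b gx * u <> 0.
  by move=> /(alg_dom F)[]; [apply: mon_neq0 | apply: (pt_neq0 pu)].
set cp := W b k (G *m xneg r j); set cq := W b k (G *m xpos r j).
have lbp c : c <= cp -> lowb (W b k) c (vp Q al *: zp).
  by move=> cc h /supp_coefZ /(pt_lowb (predC1 k) pp); apply: le_trans.
have lbq c : c <= cq -> lowb (W b k) c (vp Q be *: zq).
  by move=> cc h /supp_coefZ /(pt_lowb (predC1 k) pq); apply: le_trans.
(* A nonzero component of the right side of [E] at a lower bound [c] of its weights is the lowest
   one, so it equals that of the left side. *)
have find c y : c <= cp -> c <= cq ->
    gcomp (W b k) c (vp Q al *: zp + vp Q be *: zq) = y -> y <> 0 -> X b gx * u = y.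
  move=> c1 c2 <- y0; rewrite -lowE E; congr gcomp; rewrite -E in y0.
  apply: min_weight_uniq lowbE _ _ y0; rewrite ?lowE // E => h; rewrite coefD => H.
  have [e0|/eqP] := eqVneq (coef (vp Q al *: zp) h) 0; last exact: lbp.
  by move: H; rewrite e0 add0r; apply: lbq.
have other (P : pred 'I_n) l : (forall i, 0 <= C i j) \/ (forall i, C i j <= 0) ->
    C l j != 0 -> P l -> if 0 <= C l j then 0 < wt b P (Bt b *m col j C)
    else wt b P (Bt b *m col j C) < 0.
  move=> sg nz Pl; rewrite wt_Bt; case: (leP 0 (C l j)) => Cl.
    case: sg => sg; last by move: nz; rewrite eq_le Cl sg.
    rewrite (bigD1 l) //= ltr_pwDl //; last first.
      by apply: sumr_ge0 => i _; rewrite mxE mulr_ge0 // ltW // diagD_gt0.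
    by rewrite mxE mulr_gt0 ?diagD_gt0 // lt_neqAle eq_sym nz.
  case: sg => sg; first by move: (sg l); rewrite leNgt Cl.
  rewrite (bigD1 l) //= -oppr_gt0 opprD ltr_pwDl //.
    by rewrite mxE -mulrN mulr_gt0 ?diagD_gt0 // oppr_gt0.
  rewrite oppr_ge0; apply: sumr_le0 => i _.
  by rewrite mxE mulr_ge0_le0 // ltW // diagD_gt0.
have [/existsP[l /andP[lk Cl]]|/existsPn N] := boolP [exists l, (l != k) && (C l j != 0)].
  have ug : u = X b g'.
    have ecq : cq = cp + W b k (Bt b *m col j C) by rewrite /cq eGq wD.
    have := other (predC1 k) l (sC j) Cl lk; case: (leP 0 (C l j)) => _ lt.
      apply: (mon_quot (g := gx) (h := G *m xneg r j) (c := al)) pu.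
      apply: (find cp) => //; first by rewrite ecq lerDl ltW.
        by rewrite gcompD !gcompZ lp (gcomp_lt (pt_lowb _ pq)) ?scaler0 ?addr0 // -/cq ecq ltrDl.
      by move=> /scalev_eq0; apply: mon_neq0.
    apply: (mon_quot (g := gx) (h := G *m xpos r j) (c := be)) pu.
    apply: (find cq) => //; first by rewrite ecq gerDl ltW.
      by rewrite gcompD !gcompZ lq (gcomp_lt (pt_lowb _ pp)) ?scaler0 ?add0r // -/cp -/cq ecq gtrDl.
    by move=> /scalev_eq0; apply: mon_neq0.
  left=> i; have [->|ij] := eqVneq i (uf j); last by rewrite same.
  exists g', x'; [exact: ex' | split=> //].
  (* The sign of the new coordinate comes from Laurentness at [b']: the matching component of [z2]
     maps to the monomial [X b g']. *)
  apply: (mm_laurent mm mK nK (z' := gcomp (W b' k) (W b k g') z2)).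
  have e2 : mu_ (iF z2) = iF x' by rewrite -ez2 nK ex'.
  by rewrite (mm_gcomp mm _ e2) -/u ug.
right.
have C0 l : l != k -> C l j = 0.
  by move=> lk; have := N l; rewrite lk negbK => /eqP.
have dual i : diagD b k * C k j * G (uf k) i = diagD b j * (i == uf j)%:R.
  rewrite -(gmat_dual rf gm eC) (bigD1 k) //= big1 ?addr0 // => l /C0 ->.
  by rewrite mulr0 mul0r.
have dk := diagD_gt0 b k; have dj := diagD_gt0 b j.
(* The value -1 contradicts [dual] at [uf j], since row [k] of [G] is nonnegative. *)
have Ck : C k j = 1.
  have [//|e] := cmat_col_unit rf gm eC C0; move: (dual (uf j)) (G0 (uf j)).
  by rewrite e eqxx; nia.
have Gi i : i != uf j -> G (uf k) i = 0.
  by move=> ij; move: (dual i); rewrite Ck (negbTE ij); nia.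
have Gj : G (uf k) (uf j) = 1.
  have Guf i : i != j -> G (uf k) (uf i) = 0.
    by move=> ij; apply: Gi; rewrite (inj_eq (@lshift_inj _ _)).
  have [//|e] := gmat_row_unit rf gm eC Guf.
  by move: (G0 (uf j)); rewrite e.
have eCy : Bt b *m col j C = ydeg b k.
  rewrite ydegE; congr (_ *m _); apply/matrixP => i l; rewrite !mxE ord1 eqxx andbT.
  by case: eqVneq => [->//|/C0 ->].
pose h := G *m mneg r j.
have hp : gx + h = G *m xneg r j by rewrite -mulmxDr /mneg addrA subrr add0r.
have hq : h + ydeg b k = G *m mpos r j.
  by rewrite mposE mulmxDr (cmat_ydeg eC) eCy.
have hq' : gx + (h + ydeg b k) = G *m xpos r j.
  by rewrite hq -mulmxDr /mpos addrA subrr add0r.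
have ecq : cq = cp by rewrite /cq eGq eCy wD wt_ydegC addr0.
have eu : u = X b h + X b (h + ydeg b k).
  apply: (alg_mulI F (mon_neq0 (t := b) (g := gx))).
  have -> : X b gx * (X b h + X b (h + ydeg b k)) =
      vp Q al *: X b (G *m xneg r j) + vp Q be *: X b (G *m xpos r j).
    by rewrite mulrDr !monM hp hq' hq !Gf.
  apply: (find cp); rewrite ?ecq //.
    by rewrite gcompD !gcompZ lp -lq -/cp -/cq ecq.
  move=> e0; have := congr1 (fun y => coef y (G *m xneg r j)) e0.
  rewrite coef0 coefD !coefZ coef_monX mulr1 coef_mon eGq eCy.
  case: eqP => [e1|_]; last by rewrite mulr0 addr0; apply: vp_neq0.
  by move: (@ydeg_neq0 _ _ b k) => []; apply: (addrI (G *m xneg r j)); rewrite e1 addr0.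
have hk : h (uf k) 0 = -1.
  rewrite /h mxE (bigD1 (uf j)) //= Gj mneg_k big1 ?addr0 ?mul1r // => i ij.
  by rewrite Gi // mul0r.
(* The degree at [b'] whose monomial expands at [b] to the binomial [u]. *)
pose h' := h - mneg b k + bas (uf k).
have h'k : h' (uf k) 0 = 1.
  by rewrite /h' mxE mxE [X in _ + X + _]mxE hk mneg_k basE eqxx.
have Eh' : mutE b k *m h' = h.
  by rewrite mutEE h'k scale1r /h' -addrA [bas _ + _]addrC !subrK.
have transf i g z h1 : pt g z -> f (mst (k := j) (iF (X (mu r j) (bas i)))) = iF z ->
    mu_ (iF (X b' h1)) = iF (gcomp (W b k) (W b k g) z) -> 0 <= h1 (uf k) 0 ->
    exists g, exists2 z, nu_ (f (mst (k := j) (iF (X (mu r j) (bas i))))) = iF z &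
      low_mon k g z /\ 0 <= g (uf k) 0.
  move=> pz ez eh h10; have [g3 [z3 ez3 pz3]] := Dpt Db' (route_trans rfj rn) i.
  have e3 : mu_ (iF z3) = iF z by rewrite -ez3 nK.
  have [eg lz] := low_mon_pt pz3 (mm_transfer mm pz pz3 e3 eh).
  by exists g3, z3 => //; split; rewrite // -eg.
move=> i; have [->|ij] := eqVneq i (uf j).
  apply: (transf (uf j) g' x' h' px' ex'); last by rewrite h'k.
  by rewrite (mm_mon1 mm h'k) Eh' -/u eu.
have [z ez [pz lz]] := gl i; have gik : (G *m bas i) (uf k) 0 = 0.
  by rewrite mulmx_bas mxE Gi.
apply: (transf i (G *m bas i) z (G *m bas i) pz); rewrite ?gik // ?same //.
by rewrite (mm_mon0 mm gik) lz.
Qed.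

(** Induction on the route; [b] and [mu b k] play symmetric roles, so [Splus_mut] serves in both
    alternatives. *)
Lemma Splus_dichotomy b k r (f : F r -> F b) : D b -> route f ->
  Splus k f \/ Splus k (fun x => mst_inv k (f x)).
Proof.
move=> Db rf; have Db' := Dmu k Db.
elim: r f / rf => [f ef|r j f f' rf IH ef'].
  left=> i; exists (bas i), (X b (bas i)); first by rewrite ef.
  by split; [split; [apply: ptX | apply: gcomp_id; apply: homog_mon] | rewrite basE].
have mK := @mstK b k; have nK := @mst_invK b k.
case: IH => S.
  have [H|H] := Splus_mut j (mstP b k) mK nK (route_mst_inv b k) Db Db' rf S.
    by left; apply: Splus_ext H.
  by right; apply: Splus_ext H => x; rewrite ef'.
have rf' := route_trans rf (route_mst_inv b k).
have [H|H] := Splus_mut j (mutmap_mst_inv b k) nK mK (route_mst b k) Db' Db rf' S.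
  by right; apply: Splus_ext H => x; rewrite ef'.
by left; apply: Splus_ext H => x; rewrite ef' nK.
Qed.

(** In the second alternative [mm_phi] starts from [mu b k], and its conclusion is inverted by
    [phi_invol]. *)
Lemma gvector_phi b k r (f : F r -> F b) i g g' (z : A b) (z' : A (mu b k)) :
  D b -> route f -> f (iF (X r (bas i))) = iF z -> pt g z ->
  mst_inv k (f (iF (X r (bas i)))) = iF z' -> pt g' z' -> g' = phi b k g.
Proof.
move=> Db rf ez pz ez' pz'; have mK := @mstK b k; have nK := @mst_invK b k.
have [S|S] := Splus_dichotomy k Db rf; have [g1 [z1 ez1 [l1 g10]]] := S i.
  have ? : z1 = z by apply: (@sf_in_inj _ (F b)); rewrite -ez1 -ez.
  subst z1; have ? := pt_uniq l1.1 pz; subst g1.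
  by apply: (mm_phi (mstP b k) mK nK l1 g10 pz'); rewrite -ez' nK.
have ? : z1 = z' by apply: (@sf_in_inj _ (F _)); rewrite -ez1 -ez'.
subst z1; have ? := pt_uniq l1.1 pz'; subst g1.
have -> : g = phi (mu b k) k g'.
  by apply: (mm_phi (mutmap_mst_inv b k) nK mK l1 g10 pz); rewrite -ez' ez.
by rewrite (phi_invol _ (mutmap_mst_inv b k).(mm_adj)).
Qed.

Lemma form_mulrnl t g p h : form (La t) (g *+ p) h = form (La t) g h *+ p.
Proof. by rewrite -[g *+ p]scaler_nat formZl mulr_natl. Qed.

Lemma pt_exp t g (z : A t) p : pt g z -> pt (g *+ p) (z ^+ p).
Proof.
move=> pz; elim: p => [|p IH]; first by rewrite expr0 -(mon0 Q t); apply: ptX.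
rewrite exprSr mulrSr.
by have := ptM IH pz; rewrite form_mulrnl formxx mul0rn oppr0 vp0 scale1r.
Qed.

Lemma mon_exp t g p : X t (g *+ p) = X t g ^+ p.
Proof.
elim: p => [|p IH]; first by rewrite expr0 mon0.
by rewrite mulrSr exprSr monD IH form_mulrnl formxx mul0rn oppr0 vp0 scale1r.
Qed.

(** * Degrees and supports at [s] and at its shift [t = s[1]] *)

Section Shift.
Variables (s t : qseed n m) (th : F t -> F s) (sigma : {perm 'I_n}).
Hypotheses (Ds : D s) (rth : route th).
Hypothesis shift : forall k', exists g, exists2 z,
  th (iF (X t (bas (uf (sigma k'))))) = iF z &
  pt g z /\ forall j, g (uf j) 0 = - (j == k')%:R.
Let hth := route_ishom rth.

Variable G : 'M[int]_(n + m).
Hypothesis gm : gmat th G.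
Let Gf := gmat_form rth gm.

Lemma shift_gmat i k : G (uf i) (uf (sigma k)) = - (i == k)%:R.
Proof.
have [g [z ez [pz gz]]] := shift k; have [z1 ez1 p1] := gm (uf (sigma k)).
have ? : z1 = z by apply: (@sf_in_inj _ (F s)); rewrite -ez -ez1.
by subst z1; rewrite -gz -(pt_uniq p1 pz) mulmx_bas mxE.
Qed.

(** Duality with the known columns of [G] confines each column of [C] to one entry. As [diagD] at
    [i] and at [sigma i] are not known to agree, its absolute value comes from unimodularity and its
    sign from positivity. *)
Lemma shift_cmat (C : 'M[int]_n) : G *m Bt t = Bt s *m C ->
  forall i j, C i j = - (sigma i == j)%:R.
Proof.
move=> eC.
have dual i j : diagD s i * C i j = - (diagD s j * (sigma i == j)%:R).
  have := gmat_dual rth gm eC j (uf (sigma i)); rewrite (inj_eq (@lshift_inj _ _)) => <-.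
  rewrite (bigD1 i) //= big1 ?addr0 => [|l li]; first by rewrite shift_gmat eqxx mulrN1 opprK.
  by rewrite shift_gmat (negbTE li) oppr0 mulr0.
have C0 i j : sigma i != j -> C i j = 0.
  by move=> ij; move: (dual i j) (diagD_gt0 s i); rewrite (negbTE ij); nia.
move=> i j; have [e|ij] := eqVneq (sigma i) j; last by rewrite C0 ?oppr0.
have Cl l : l != i -> C l j = 0.
  by move=> li; apply: C0; rewrite -e (inj_eq (@perm_inj _ _)).
have [e1|->] := cmat_col_unit rth gm eC Cl; last by [].
by move: (dual i j) (diagD_gt0 s i) (diagD_gt0 s j); rewrite e1 e eqxx; nia.
Qed.

Lemma shift_G_Bt a : G *m (Bt t *m a) = Bt s *m (\col_i - a (sigma i) 0).
Proof.
have [C [eC _]] := cmat_exists Ds rth gm; have CE := shift_cmat eC.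
rewrite mulmxA eC -mulmxA; congr (_ *m _); apply/matrixP => i j; rewrite !mxE ord1.
rewrite (bigD1 (sigma i)) //= CE eqxx mulN1r big1 ?addr0 // => l li.
by rewrite CE eq_sym (negbTE li) oppr0 mul0r.
Qed.

Lemma shift_G_ydeg k : G *m ydeg t (sigma k) = - ydeg s k.
Proof.
rewrite !ydegE shift_G_Bt -mulmxN; congr (_ *m _); apply/matrixP => i j.
by rewrite !mxE ord1 !eqxx !andbT (inj_eq (@perm_inj _ _)).
Qed.

Lemma shift_G_inj a a' h : G *m (h + Bt t *m a) = G *m (h + Bt t *m a') -> a = a'.
Proof.
rewrite !mulmxDr => /addrI; rewrite !shift_G_Bt => /Bt_inj/matrixP e.
apply/matrixP => i j; have := e ((sigma^-1)%g i) 0; rewrite !mxE permKV ord1.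
exact: oppr_inj.
Qed.

(* No cancellation can occur at a degree [G h'] which no other term of [z] dominates. *)
Lemma leading_term (z : A t) (w : A s) h' :
  (forall h, coef z h <> 0 -> forall i, 0 <= h i 0) ->
  (forall h, coef z h <> 0 -> dom s (G *m h) (G *m h') -> h = h') ->
  th (iF z) = iF w -> coef w (G *m h') = coef z h'.
Proof.
move=> z0 hmax ew; suff [w' ew' <-] : exists2 w', th (iF z) = iF w' &
    coef w' (G *m h') = coef z h'.
  by congr coef; apply: (@sf_in_inj _ (F s)); rewrite -ew -ew'.
rewrite (alg_sum z).
elim/big_rec: _ => [|h y _ [w1 e1 c1]].
  by exists 0; rewrite ?rmorph0 ?(hom0 hth) // !coef0.
have [->|/eqP nz] := eqVneq (coef z h) 0; first by exists w1; rewrite scale0r add0r.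
have [u eu [cu du]] := gmat_ge0 rth gm (z0 h nz).
exists (coef z h *: u + w1); first by apply: exp_D => //; apply: exp_Z.
rewrite !coefD !coefZ c1 coef_mon; congr (_ * _ + _).
case: eqP => [<-|ne]; first by [].
by apply/eqP; apply: contra_notT ne => /eqP/du/(hmax h nz).
Qed.

(** An extremal term of [z] cannot cancel in [w], so its image degree is dominated by [gs]. Choosing
    the term of least weight extends the bound to all terms. *)
Lemma supp_bound g gs (z : A t) (w : A s) i h : pt g z -> pt gs w -> th (iF z) = iF w ->
  coef z h <> 0 -> wt s (pred1 i) gs <= wt s (pred1 i) (G *m h).
Proof.
move=> [_ dz] pw ew zh.
(* Multiplication by [X t H] makes all exponents nonnegative, so that every monomial has a pointed
   expansion at [s]. *)
have [H H0 zH] : exists2 H : lattice, (forall j, 0 <= H j 0) &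
    forall h, coef z h <> 0 -> forall j, 0 <= (h + H) j 0.
  suff [H H0 zH] : exists2 H : lattice, (forall j, 0 <= H j 0) &
      forall h, h \in supp z -> forall j, 0 <= (h + H) j 0.
    by exists H => // h' nz; apply: zH; apply: contraPT nz => /coef_out ->.
  elim: (supp z) => [|h1 l [H H0 IH]]; first by exists 0 => // j; rewrite mxE.
  exists (H + \col_j `|h1 j 0|) => [j|h2]; first by rewrite !mxE addr_ge0.
  rewrite inE => /orP[/eqP -> j|/IH H2 j].
    by move: (H0 j); rewrite !mxE; move: (H j 0) (h1 j 0) => a c; lia.
  by move: (H2 j); rewrite !mxE; move: (H j 0) (h1 j 0) (h2 j 0) => a b c; lia.
pose wi := fun h => wt s (pred1 i) (G *m h); pose wT := fun h => wt s predT (G *m h).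
have z0 : z <> 0 by move=> z0; apply: zh; rewrite z0 coef0.
(* Minimize first [wi], then the total weight: the second choice ensures that no other term of [z]
   dominates the chosen one at [s]. *)
have [h1 zh1 lz] := ex_min_weight wi z0.
have [h2] := ex_min_weight wT (gcomp_neq0 (w := wi) zh1).
rewrite coef_gcomp; case: eqP => // e21 zh2 lT.
apply: le_trans (lz _ zh); rewrite -e21 {h zh}.
have hmax h : coef z h <> 0 -> dom s (G *m h) (G *m h2) -> h = h2.
  move=> zh dh; have eh : wi h = wi h1.
    by apply/eqP; rewrite eq_le (lz h zh) andbT -e21; apply: dom_wt dh.
  have lt : wT h2 <= wT h by apply: lT; rewrite coef_gcomp eh eqxx.
  have := dom_wt_eq dh lt; have [a [_ ->]] := dz _ zh; have [a2 [_ ->]] := dz _ zh2.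
  by move=> /shift_G_inj ->.
pose zH' := z * X t H.
have supH h : coef zH' h <> 0 -> exists2 h0, coef z h0 <> 0 & h = h0 + H.
  by move=> /suppM[a [b [za /supp_mon -> ->]]]; exists a.
have [xi exi [cxi dxi]] := gmat_ge0 rth gm H0.
have e := @leading_term zH' (w * xi) (h2 + H) _ _ (exp_M hth ew exi).
have ne : coef (w * xi) (G *m (h2 + H)) <> 0.
  rewrite e.
  - rewrite coefM_single; last first.
      by move=> a b _ /supp_mon -> /addIr ->.
    rewrite coef_monX mulr1 => e0; apply: zh2.
    by rewrite -[LHS]mul1r -(vpK Q (form (La t) h2 H)) -mulrA e0 mulr0.
  - by move=> h /supH[h0 zh0 ->]; apply: zH.
  move=> h /supH[h0 zh0 ->]; rewrite !mulmxDr => -[a [a0 ea]].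
  congr (_ + _); apply: hmax => //; exists a; split=> //.
  by apply: (addIr (G *m H)); rewrite ea addrAC.
have [_ dw] := pw; have := supp_domM dw dxi ne; rewrite mulmxDr => -[a [a0 ea]].
have dh2 : dom s gs (G *m h2).
  by exists a; split=> //; apply: (addIr (G *m H)); rewrite ea addrAC.
exact: dom_wt dh2.
Qed.

Variable k' : 'I_n.
Local Notation k := (sigma k').

Lemma shift_newvar_degree gA (zA : A s) :
  th (mst (iF (X (mu t k) (bas (uf k))))) = iF zA -> pt gA zA -> gA = G *m mpos t k.
Proof.
move=> eA [cA dA]; have [x ex [cx dx]] := gm (uf k).
have [zp ep [cp dp]] := gmat_ge0 rth gm (xneg_ge0 t k).
have [zq eq [cq dq]] := gmat_ge0 rth gm (xpos_ge0 t k).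
have E := exchange rth ex eA ep eq.
set al := vp Q _ in E; set be := vp Q _ in E.
have eGq : G *m xneg t k = G *m xpos t k + ydeg s k'.
  by rewrite xposE mulmxDr shift_G_ydeg subrK.
have dqp : dom s (G *m xpos t k) (G *m xneg t k).
  exists (delta_mx k' 0); rewrite -ydegE; split=> // i.
  by rewrite mxE; case: (_ && _).
have de : dom s (G *m xpos t k) (G *m bas (uf k) + gA).
  have : coef (x * zA) (G *m bas (uf k) + gA) <> 0.
    by rewrite (coef_domM dx dA) cx cA !mulr1; apply: vp_neq0.
  rewrite E coefD !coefZ.
  have [-> H|/eqP/dp H _] := eqVneq (coef zp (G *m bas (uf k) + gA)) 0.
    by apply: dq => e0; apply: H; rewrite e0 !mulr0 addr0.
  exact: dom_trans dqp H.
have ed : dom s (G *m bas (uf k) + gA) (G *m xpos t k).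
  apply: (supp_domM dx dA); rewrite E coefD !coefZ cq mulr1.
  have [->|/eqP/dp H] := eqVneq (coef zp (G *m xpos t k)) 0.
    by rewrite mulr0 add0r; apply: vp_neq0.
  have := dom_anti dqp H; rewrite eGq -[LHS]addr0 => /addrI/esym e0.
  by case: (@ydeg_neq0 _ _ s k').
apply: (addrI (G *m bas (uf k))); rewrite (dom_anti ed de) -mulmxDr /mpos.
by rewrite addrA subrr add0r.
Qed.

Lemma wtN b P g : wt b P (- g) = - wt b P g.
Proof. exact: formNl. Qed.

Lemma wt_mulrn b P g p : wt b P (g *+ p) = wt b P g *+ p.
Proof. exact: form_mulrnl. Qed.

(** The degree at [s] is [G] of the other end of the segment, [d] steps of [Y_k] away. [supp_bound]
    then bounds the exponent of [Y_k] by [d] and the others by 0. *)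
Lemma shift_line_supp d (z : A t) (w : A s) h :
  pt (mneg t k *+ d) z -> th (iF z) = iF w -> pt ((G *m mpos t k) *+ d) w ->
  coef z h <> 0 -> exists2 j, (j <= d)%N & h = mneg t k *+ d + ydeg t k *+ j.
Proof.
move=> pz ew pw zh; have [a [a0 eh]] := pz.2 h zh.
set g := mneg t k *+ d in pz eh *.
have GX x p : G *m (x *+ p) = (G *m x) *+ p by exact: raddfMn.
have wt_a i : wt s (pred1 i) (G *m h) = wt s (pred1 i) (G *m g) - diagD s i * a (sigma i) 0.
  by rewrite eh [G *m (g + _)]mulmxDr shift_G_Bt wtD wt_Bt big_pred1_eq mxE mulrN.
have wt_d i : wt s (pred1 i) ((G *m mpos t k) *+ d)
    = wt s (pred1 i) (G *m g) - diagD s i * ((i == k')%:R * d%:Z).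
  rewrite mposE [G *m (mneg t k + _)]mulmxDr shift_G_ydeg -scaler_nat scalerDr scalerN.
  rewrite !scaler_nat -GX -/g wtD; congr (_ + _).
  rewrite -scaler_nat -scaleNr ydegE scalemxAr wt_Bt big_pred1_eq !mxE eqxx andbT.
  rewrite mulNr mulrN; congr (- (_ * _)); rewrite mulrC; congr (_ * _).
  exact: natz.
have bound i : a (sigma i) 0 <= (i == k')%:R * d%:Z.
  have := supp_bound i pz pw ew zh; rewrite wt_a wt_d lerD2l lerN2.
  by rewrite ler_pM2l ?diagD_gt0.
have ak i : i != k -> a i 0 = 0.
  move=> ik; have := bound ((sigma^-1)%g i); rewrite permKV.
  have -> : ((sigma^-1)%g i == k') = false.
    by apply/negbTE; apply: contraNneq ik => <-; rewrite permKV.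
  by rewrite mul0r => a1; apply/eqP; rewrite eq_le a1 a0.
have [j ej] : exists j : nat, a k 0 = j%:Z.
  by case: (a k 0) (a0 k) => // j _; exists j.
exists j; first by have := bound k'; rewrite eqxx mul1r ej.
rewrite eh; congr (_ + _); rewrite ydegE -scaler_nat scalemxAr; congr (_ *m _).
apply/matrixP => i l; rewrite !mxE ord1 eqxx andbT.
by case: eqVneq => [->|/ak ->]; rewrite ?mulr0 // mulr1 ej natz.
Qed.

Lemma shift_gmat_row i : i != uf k -> G (uf k') i = 0.
Proof.
move=> ik; have [C [eC _]] := cmat_exists Ds rth gm.
have := gmat_dual rth gm eC k i; rewrite (bigD1 k') //= big1 => [|l lk]; last first.
  by rewrite (shift_cmat eC) (inj_eq (@perm_inj _ _)) (negbTE lk) oppr0 mulr0 mul0r.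
rewrite (shift_cmat eC) eqxx addr0 (negbTE ik) mulr0 mulrN1 mulNr => /eqP.
by rewrite oppr_eq0 mulf_eq0 gt_eqF ?diagD_gt0 // => /eqP.
Qed.

(* The row [k'] of [G] has a negative entry, which leaves only the alternative of
   [Splus_dichotomy] at [mu s k']. *)
Lemma shift_low i : exists2 z, th (iF (X t (bas i))) = iF z & pt (G *m bas i) z /\
  exists2 h : lattice, h (uf k') 0 = - G (uf k') i &
    mst (iF (X (mu s k') h)) = iF (gcomp (W s k') (W s k' (G *m bas i)) z).
Proof.
have [S|S] := Splus_dichotomy k' Ds rth.
  have [g [z ez [lz]]] := S (uf k); have [z1 ez1 p1] := gm (uf k).
  have ? : z1 = z by apply: (@sf_in_inj _ (F s)); rewrite -ez -ez1.
  by subst z1; rewrite -(pt_uniq p1 lz.1) mulmx_bas mxE shift_gmat eqxx.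
have [g [z' ez' [lz g0]]] := S i; have [z ez pz] := gm i.
exists z => //; split=> //; exists g.
  have := mm_phi (mutmap_mst_inv s k') (@mst_invK s k') (@mstK s k') lz g0 pz.
  rewrite -ez => /(_ ez') eg; move/matrixP: eg => /(_ (uf k') 0).
  by rewrite mulmx_bas !mxE eqxx => ->; rewrite opprK.
have [u eu _] := mm_mon_ge0 (mstP s k') g0; rewrite eu; congr (iF _); apply/esym.
apply: (mm_transfer (mutmap_mst_inv s k') lz.1 pz); first by rewrite -ez.
by rewrite -eu mstK lz.2.
Qed.

Lemma shift_low_mon i : i != uf k -> expands th G (fun g z => low_mon k' g z) (bas i).
Proof.
move=> ik; have [z ez [pz [h hk eh]]] := shift_low i; exists z => //.
have hk0 : h (uf k') 0 = 0 by rewrite hk shift_gmat_row ?oppr0.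
have := eh; rewrite (mm_mon0 (mstP s k') hk0) => /sf_in_inj e.
by have [] := low_mon_pt pz (esym e).
Qed.

Lemma shift_low_binomial : exists2 z, th (iF (X t (bas (uf k)))) = iF z &
  pt (G *m bas (uf k)) z /\
  spread (wt s (pred1 k')) (diagD s k') (gcomp (W s k') (W s k' (G *m bas (uf k))) z).
Proof.
have [z ez [pz [h hk eh]]] := shift_low (uf k); exists z => //; split=> //.
have hk1 : h (uf k') 0 = 1 by rewrite hk shift_gmat eqxx opprK.
have := eh; rewrite (mm_mon1 (mstP s k') hk1) => /sf_in_inj <-.
exact: spread_binomial.
Qed.

Lemma ydeg_mulrn_inj b i p q : ydeg b i *+ p = ydeg b i *+ q -> p = q.
Proof.
move=> /(congr1 (wt b (pred1 i))); rewrite !wt_mulrn wt_ydeg.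
exact: (mulrIn (lt0r_neq0 (diagD_gt0 b i))).
Qed.

(* Write [x] for the variable [X_k(t)] seen from [s]. If [z] differs from the power
   [a ^+ d], then [(z - a ^+ d) * x ^+ d] is a combination of [d] consecutive monomials on
   the line of direction [ydeg s k'] in its lowest degree; but the lowest part of
   [x ^+ d] alone already spreads over [d + 1] of them. *)
Theorem shift_pointed_power d (z : A t) (w zA : A s) gA :
  pt (mneg t k *+ d) z -> th (iF z) = iF w ->
  th (mst (iF (X (mu t k) (bas (uf k))))) = iF zA -> pt gA zA -> pt (gA *+ d) w ->
  iF z = mst (iF (X (mu t k) (bas (uf k)))) ^+ d.
Proof.
move=> pz ew eA pA pw; have eg := shift_newvar_degree eA pA; subst gA.
have [a ea [pa _]] : exists2 a, mst (iF (X (mu t k) (bas (uf k)))) = iF a &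
    pt_line k (mutE t k *m bas (uf k)) a.
  by apply: (mm_mon_ge0 (mstP t k)); rewrite basE eqxx.
rewrite mutE_bas mut_basE eqxx in pa.
rewrite ea in eA *; rewrite -rmorphXn; congr (iF _); apply/eqP.
rewrite -subr_eq0; apply/negPn/negP => /eqP nz; set z1 := z - a ^+ d in nz.
have pad := pt_exp d pa; have ewA := exp_X hth d eA; have pwA := pt_exp d pA.
set g := mneg t k *+ d in pz pad; set y := ydeg t k; set y' := ydeg s k'.
pose q := xneg t k *+ d; pose bd : lattice := bas (uf k) *+ d.
have line h : coef z1 h <> 0 -> exists j, [/\ (0 < j)%N, (j <= d)%N & h = g + y *+ j].
  move=> zh; have [j jd eh] : exists2 j, (j <= d)%N & h = g + y *+ j.
    have [e0|/eqP] := eqVneq (coef z h) 0; last exact: (shift_line_supp pz ew pw).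
    apply: (shift_line_supp pad ewA pwA) => e1.
    by apply: zh; rewrite coefD coefN e0 e1 subrr.
  (* The term [j = 0] cancels, as [z] and [a ^+ d] both have coefficient 1 there; [d] positions
     remain. *)
  exists j; split=> //; case: j jd eh => // _ eh; case: zh.
  by rewrite eh mulr0n addr0 coefD coefN pz.1 pad.1 subrr.
pose om := w - zA ^+ d.
have eom : th (iF z1) = iF om by rewrite !rmorphB (homB hth) ew ewA.
have [x ex [px sx]] := shift_low_binomial.
pose U := z1 * X t bd.
have eU : th (iF U) = iF (om * x ^+ d).
  by apply: (exp_M hth eom); rewrite mon_exp; apply: exp_X.
have gq : g + bd = q by rewrite -mulrnDl /mneg addrAC addNr add0r.
have lineU h : coef U h <> 0 -> exists j, [/\ (0 < j)%N, (j <= d)%N & h = q + y *+ j].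
  move=> /suppM[h1 [h2 [/line[j [j0 jd ->]] /supp_mon -> ->]]]; exists j; split=> //.
  by rewrite addrAC gq.
have GX h p : G *m (h *+ p) = (G *m h) *+ p by exact: raddfMn.
have Gline j : G *m (q + y *+ j) = G *m q - y' *+ j.
  by rewrite [LHS]mulmxDr GX shift_G_ydeg mulNrn.
pose c := W s k' (G *m q).
have Wline j : W s k' (G *m q - y' *+ j) = c.
  by rewrite wtD wtN wt_mulrn /y' wt_ydegC mul0rn oppr0 addr0.
have [u eu [lu su cu]] : exists2 u, th (iF U) = iF u & [/\ lowb (W s k') c u,
    forall h, coef (gcomp (W s k') c u) h <> 0 ->
      exists j, [/\ (0 < j)%N, (j <= d)%N & h = G *m q - y' *+ j] &
    forall j, coef (gcomp (W s k') c u) (G *m q - y' *+ j) = coef U (q + y *+ j)].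
  rewrite (alg_sum U); elim/big_rec: _ => [|h v _ [u1 e1 [l1 s1 c1]]].
    exists 0; first by rewrite !rmorph0 (hom0 hth).
    by split=> [h|h|j]; rewrite ?gcomp0 !coef0.
  have [->|/eqP nh] := eqVneq (coef U h) 0; first by exists u1; rewrite scale0r add0r.
  have [j [j0 jd eh]] := lineU h nh.
  (* The factor [X t bd] was chosen for this: the exponents are now nonnegative and do not involve
     [X_k], so each monomial of [U] has a monomial lowest part at [s]. *)
  have hj : h = xneg t k *+ (d - j) + xpos t k *+ j.
    by rewrite eh xposE mulrnDl addrA -mulrnDr subnK.
  have h0 i : 0 <= h i 0.
    by rewrite hj mxE !mulmxnE addr_ge0 // mulrn_wge0 ?xneg_ge0 ?xpos_ge0.
  have hk : h (uf k) 0 = 0 by rewrite hj mxE !mulmxnE xneg_k xpos_k !mul0rn addr0.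
  have [v1 ev1 [pv1 lv1]] : expands th G (fun g z => low_mon k' g z) h.
    have P2 g1 g2 x1 x2 := @low_monM s k' g1 g2 x1 x2.
    apply: (expands_sum hth Gf P2 (low_mon1 _ _)) => i.
    have [->|ik] := eqVneq i (uf k).
      by rewrite hk scale0r; apply: (expands0 hth _ (low_mon1 _ _)).
    case: (h i 0) (h0 i) => // p _; apply: (expandsMn hth Gf P2 (low_mon1 _ _)).
    exact: shift_low_mon.
  exists (coef U h *: v1 + u1); first by apply: exp_D => //; apply: exp_Z.
  have Wh : W s k' (G *m h) = c by rewrite eh Gline Wline.
  rewrite Wh in lv1; rewrite gcompD gcompZ lv1.
  split=> [h1|h1|j1].
  - rewrite coefD => H; have [e0|/eqP] := eqVneq (coef u1 h1) 0; last exact: l1.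
    have /supp_coefZ/(pt_lowb (predC1 k') pv1) : coef (coef U h *: v1) h1 <> 0.
      by move=> e2; apply: H; rewrite e0 e2 addr0.
    by rewrite Wh.
  - rewrite coefD => H.
    have [e0|/eqP] := eqVneq (coef (gcomp (W s k') c u1) h1) 0; last exact: s1.
    have /supp_coefZ/supp_mon -> : coef (coef U h *: X s (G *m h)) h1 <> 0.
      by move=> e2; apply: H; rewrite e0 e2 addr0.
    by exists j; rewrite eh Gline.
  rewrite !coefD c1 !coefZ !coef_mon; congr (_ * _%:R + _).
  rewrite {1 2}eh Gline; have [->|ne] := eqVneq j j1; first by rewrite !eqxx.
  have -> : (G *m q - y' *+ j == G *m q - y' *+ j1) = false.
    by apply/negbTE; apply: contra_neq ne => /addrI/oppr_inj/ydeg_mulrn_inj.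
  by case: eqP => // /addrI/ydeg_mulrn_inj/eqP; rewrite (negbTE ne).
have eu1 : u = om * x ^+ d by apply: (@sf_in_inj _ (F s)); rewrite -eu -eU.
have U0 : U <> 0 by move=> /(alg_dom F)[//|]; apply: mon_neq0.
have cu0 : gcomp (W s k') c u <> 0.
  have [h1 nh _] := ex_min_weight (W s k') U0; have [j [_ _ eh]] := lineU h1 nh.
  by move=> e0; apply: nh; rewrite eh -cu e0 coef0.
have om0 : om <> 0.
  by move=> e0; apply: cu0; rewrite eu1 e0 mul0r gcomp0.
have [h1 nh1 lom] := ex_min_weight (W s k') om0.
have wD P := @wtD _ _ s P.
set xl := gcomp _ _ x in sx; set be := W s k' (G *m bas (uf k)) in xl sx.
have xl0 : xl <> 0 by apply: (pt_neq0 (pt_gcomp _ px)).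
have [lxd exd] := gcomp_lowX (wD _) d (pt_lowb (predC1 k') px).
have lu' := lowbM (wD _) lom lxd; have eu' := gcomp_lowM (wD _) lom lxd.
rewrite -eu1 exd in lu' eu'.
(* The lowest part of [u] is that of [om] times the [d]-th power of that of [x], and each factor
   [xl] contributes at least one step of width. *)
have su' : spread (wt s (pred1 k')) (0 + diagD s k' *+ d) (gcomp (W s k') c u).
  have sp : spread (wt s (pred1 k')) (0 + diagD s k' *+ d)
      (gcomp (W s k') (W s k' h1) om * xl ^+ d).
    apply: (spreadM (alg_dom F (t := s)) (wD _)); first by apply: spread0; apply: gcomp_neq0.
    exact: (spreadX (alg_dom F (t := s)) d (wD _) xl0 sx).
  have -> : c = W s k' h1 + be *+ d; last by rewrite eu'.
  apply: min_weight_uniq lu cu0 lu' _; rewrite eu' => e0.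
  by have [i1 [_ [+ _ _]]] := sp; rewrite e0 coef0.
(* Positions [1] to [d] leave room for at most [d - 1] steps. *)
have [h2 [h3 [/su[j2 [j20 j2d ->]] /su[j3 [j30 j3d ->]]]]] := su'.
have ew2 j : wt s (pred1 k') (G *m q - y' *+ j)
    = wt s (pred1 k') (G *m q) - diagD s k' * j%:Z.
  by rewrite wtD wtN wt_mulrn /y' wt_ydeg -mulr_natr natz.
rewrite add0r !ew2 -mulr_natr natz; move: (diagD_gt0 s k') => d0.
have -> v e1 e2 : v - e1 - (v - e2) = e2 - e1 :> int by ring.
by rewrite -mulrBr ler_pM2l // => le; move: j20 j2d j30 j3d le; lia.
Qed.
End Shift.

End Routes.

(** * The tori [LP t] *)

Lemma vpow_inj : injective vpow.
Proof.
move=> a b e; have : (vpow a : {malg int[int]})@_b = 1 by rewrite e mcoeffUU.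
by rewrite mcoeffU; case: eqP.
Qed.

Section LPTori.
Variables n m : nat.
Local Notation lattice := ('cV[int]_(n + m)).

Lemma LP_sum (t : qseed n m) (z : LP t) :
  z = \sum_(h <- msupp (z : {malg qring[lattice]})) (z@_h : qring) *: Xmon t h.
Proof.
apply/malgP => x; have -> I (r : seq I) (f : I -> LP t) :
    (\sum_(i <- r) f i)@_x = \sum_(i <- r) (f i)@_x.
  exact: (big_morph (fun y : LP t => y@_x) (fun y1 y2 => mcoeffD x y1 y2) (mcoeff0 x)).
rewrite (big_seq_single (i := x)) ?fset_uniq // => [|/mcoeff_outdom|h hx].
- by rewrite mcoeffZ mcoeffU eqxx mulr1.
- by rewrite mcoeffZ => ->; rewrite mul0r.
by rewrite mcoeffZ mcoeffU (negbTE hx) mulr0.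
Qed.

Definition LP_tori : quantum_tori n m.
Proof.
refine (@QuantumTori n m qring vpow vpow0 vpowD vpow_inj (fun t => LP t)
  (fun t x h => x@_h) (fun t x => enum_fset (msupp (x : {malg qring[lattice]})))
  (@Xmon n m) _ _ _ _ (@XmonM n m) _ (@LP_sum)).
- by move=> t x y h; apply: mcoeffD.
- by move=> t c x h; apply: mcoeffZ.
- by move=> t g h; apply: mcoeffU.
- by [].
- by move=> t x; apply: fset_uniq.
Defined.
End LPTori.

Section Twisted.
Variables (R : comNzRingType) (M : zmodType) (chi : bicharacter R M).
Implicit Types x y : {malg R[M]}.

Lemma mcoeff_tmul_mon g y h : (tmul chi << g >> y)@_(g + h) = chi g h * y@_h.
Proof.
rewrite (tmulw chi msuppU_le (fsubset_refl _)) big_seq_fset1 raddf_sum /=.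
rewrite (big_seq_single (i := h)) ?fset_uniq // => [|/mcoeff_outdom ->|b bh].
- by rewrite mcoeffUU mcoeffU eqxx mul1r.
- by rewrite !mulr0 monalgU0 mcoeff0.
by rewrite mcoeffUU mcoeffU (inj_eq (addrI g)) (negbTE bh).
Qed.

End Twisted.

Section LPPointed.
Variables n m : nat.
Local Notation lattice := ('cV[int]_(n + m)).
Local Notation Q := (LP_tori n m).

Lemma coef_cmul_mon (t : qseed n m) g (y : LP t) h :
  (cmul (Xmon t g) y)@_h = y@_(h - g).
Proof. by rewrite -{1}[h](subrKC g) mcoeff_tmul_mon mul1r. Qed.

Lemma LP_pointed_pt (t : qseed n m) g (z : LP t) : LP_pointed g z -> @pt n m Q t g z.
Proof.
move=> [s [c [s0 ->]]]; set y : LP t := 1 + _.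
have yE a : y@_a = (a == 0)%:R + \sum_(v <- s) c v * (a == Bt t *m natvec v)%:R.
  rewrite /y (mcoeffD a) -[1]/(Xmon t 0) mcoeffU eq_sym; congr (_ + _).
  have -> I (r : seq I) (f : I -> LP t) :
      (\sum_(i <- r) f i)@_a = \sum_(i <- r) (f i)@_a.
    exact: (big_morph (fun y : LP t => y@_a) (fun y1 y2 => mcoeffD a y1 y2) (mcoeff0 a)).
  by apply: eq_bigr => v _; rewrite mcoeffZ mcoeffU eq_sym.
split.
  rewrite -[coef _ _]/((cmul (Xmon t g) y)@_g) coef_cmul_mon subrr yE eqxx.
  rewrite big_seq big1 ?addr0 // => v vs; case: eqP => [e|_]; last by rewrite mulr0.
  have v0 : v = 0.
    have e0 : natvec v = 0 by apply: (@Bt_inj _ _ t); rewrite mulmx0.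
    by apply/matrixP => i j; move/matrixP: e0 => /(_ i j); rewrite !mxE; case.
  by rewrite -v0 vs in s0.
move=> h; rewrite -[coef _ _]/((cmul (Xmon t g) y)@_h) coef_cmul_mon yE => H.
have [/eqP|ne] := eqVneq (h - g) 0; first by rewrite subr_eq0 => /eqP ->; apply: dom_refl.
have [/hasP[v vs /eqP e]|/hasPn N] := boolP (has (fun v => h - g == Bt t *m natvec v) s).
  by exists (natvec v); split; [move=> i; rewrite mxE | rewrite -e subrKC].
case: H; rewrite (negbTE ne) add0r big_seq big1 // => v /N /negbTE ->.
by rewrite mulr0.
Qed.

Lemma LP_degree_pt (t : qseed n m) g g0 (z : LP t) :
  @pt n m Q t g z -> LP_degree z g0 -> g0 = g.
Proof.
move=> [zg dz] /(_ g)[+ _] => H; apply/esym/H; split.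
  have -> : z@_g = 1 by exact: zg.
  exact/eqP/oner_neq0.
move=> g' /dz dg [[v e] ne]; apply: ne; apply: (dom_anti dg).
by exists (natvec v); split=> // i; rewrite mxE.
Qed.

(** [phi] is linear on each of two half-spaces. The case [d = 0] is apart because it may change the
    branch. *)
Lemma phi_mulrn (t : qseed n m) k g d : phi t k (g *+ d) = phi t k g *+ d.
Proof.
apply/matrixP => i j; rewrite mulmxnE !mxE !mulmxnE.
case: d => [|d]; first by rewrite !mulr0n lexx !mulr0 addr0 oppr0 if_same.
rewrite pmulrn_lge0 //; case: ifP => _; first by rewrite mulNrn.
by case: ifP => _; rewrite mulrnDl mulrnAr.
Qed.

Lemma phi_inj (t : qseed n m) k : injective (phi t k).
Proof.
move=> g h e; rewrite -(phi_invol g (seed_adj_mu t k)) e.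
exact: phi_invol (seed_adj_mu t k).
Qed.

Lemma phi_seq_mulrn (t : qseed n m) u g d : phi_seq t u (g *+ d) = phi_seq t u g *+ d.
Proof. by elim: u t g => //= k u IH t g; rewrite phi_mulrn IH. Qed.

Lemma phi_back_mulrn (t : qseed n m) u g d : phi_back t u (g *+ d) = phi_back t u g *+ d.
Proof. by elim: u t => //= k u IH t; rewrite IH phi_mulrn. Qed.

Lemma phi_back_inj (t : qseed n m) u : injective (phi_back t u).
Proof. by elim: u t => [|k u IH] t g h //= /phi_inj/IH. Qed.

End LPPointed.

(** * Words of mutations and the two parts of the theorem *)

Section Main.
Variables n m : nat.
Local Notation Q := (LP_tori n m).
Local Notation uf := (@lshift n m).
Local Notation lattice := ('cV[int]_(n + m)).
Variable F : forall t : qseed n m, skew_field_of_fractions (LP t).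
Variable mustar : forall (t : qseed n m) (k : 'I_n), mutation_iso F t k.
Variable t0 : qseed n m.
Hypothesis Hpointed : cluster_variables_pointed mustar t0.
Implicit Types (t b r : qseed n m) (k : 'I_n) (g : lattice).

Let FQ : forall t, skew_field_of_fractions (alg Q t) := F.
Let mst t k : FQ (mu t k) -> FQ t := mustar t k.
Let mst_inv t k : FQ t -> FQ (mu t k) := mi_inv (mustar t k).
Let mstK t k : cancel (@mst t k) (@mst_inv t k) := mi_funK (mustar t k).
Let mst_invK t k : cancel (@mst_inv t k) (@mst t k) := mi_invK (mustar t k).
Let D := in_Delta t0.

Let mstP t k : mutmap k (@mst t k).
Proof.
split=> //; [split|exact: mi_X|].
- exact: rmorphD.
- exact: rmorphM.
- exact: rmorph1.
- exact: mi_scalar.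
have := mi_Xk (mustar t k); rewrite !sum_bas; exact.
Qed.

Lemma mutseq_rcons t w k : mutseq t (rcons w k) = mu (mutseq t w) k.
Proof. by elim: w t => //= j w IH t. Qed.

Let Dmu t k : D t -> D (mu t k).
Proof. by move=> [w ->]; exists (rcons w k); rewrite mutseq_rcons. Qed.

Lemma in_Delta_mutseq t w : in_Delta t0 t -> in_Delta t0 (mutseq t w).
Proof. by elim: w t => //= k w IH t /(Dmu k)/IH. Qed.

Let rte b r (f : FQ r -> FQ b) := route (@mst) f.

(** The two seeds are equal but not convertible, hence the explicit transport. *)
Lemma mustar_seq_rcons t w k : exists e : mutseq t (rcons w k) = mu (mutseq t w) k,
  forall x, mustar_seq mustar (w := w) (mustar _ k (eq_rect _ (fun s => F s : Type) x _ e))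
    = mustar_seq mustar x.
Proof.
elim: w t => [|j w IH] t /=; first by exists erefl.
by have [e H] := IH (mu t j); exists e => x; rewrite H.
Qed.

(** Routes grow at their far end, while [mustar_seq] unfolds from the head; this makes [Hpointed],
    stated for words, available for routes. *)
Let route_word b r (f : FQ r -> FQ b) : rte f -> exists w, exists e : mutseq b w = r,
  forall x, f (eq_rect _ (fun s => F s : Type) x _ e) = mustar_seq mustar x.
Proof.
elim=> {r f} [f ef|r k f f' _ [w [e H]] ef']; first by exists [::], erefl.
case: r / e f f' H ef' => f f' H ef'; exists (rcons w k).
have [e He] := mustar_seq_rcons b w k; exists e => x; rewrite ef' -He -H; congr f.
Qed.

Let route_mustar_seq t w : rte (mustar_seq mustar (t := t) (w := w)).
Proof.
elim: w t => [|k w IH] t; first exact: RouteId.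
exact: route_trans (IH (mu t k)) (route_mst _ t k).
Qed.

Let route_mustar_seq_inv t w : rte (mustar_seq_inv mustar (t := t) w).
Proof.
elim: w t => [|k w IH] t; first exact: RouteId.
exact: route_trans (route_mst_inv mstP mstK mst_invK t k) (IH (mu t k)).
Qed.

Lemma mustar_seqK t w x : mustar_seq mustar (mustar_seq_inv mustar (t := t) w x) = x.
Proof.
elim: w t x => [//|k w IH] t x.
exact: etrans (congr1 (mustar t k) (IH _ (mi_inv (mustar t k) x))) (mi_invK _ x).
Qed.

Lemma pointed_pt t g (x : F t) : pointed g x ->
  exists2 z : alg Q t, x = sf_in (FQ t) z & pt g z.
Proof. by move=> [z [-> /LP_pointed_pt pz]]; exists z. Qed.

Lemma pointed_uniq t g h (x : F t) : pointed g x -> pointed h x -> g = h.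
Proof.
move=> /pointed_pt[z -> pz] /pointed_pt[z1 /(@sf_in_inj _ (FQ t)) e pz1].
by subst z1; apply: pt_uniq pz pz1.
Qed.

Let Dpt b : D b -> forall r (f : FQ r -> FQ b), rte f ->
  forall i, exists g, exists2 z, f (sf_in (FQ r) (mon Q r (bas i))) = sf_in (FQ b) z & pt g z.
Proof.
move=> Db r f rf i; have [w [e H]] := route_word rf.
case: r / e f rf H => f rf H; have [g pg] := Hpointed Db w i; exists g.
by have [z ez pz] := pointed_pt pg; exists z => //; rewrite -ez -H.
Qed.

Lemma degree_pt t g g0 (x : F t) (z : alg Q t) :
  x = sf_in (FQ t) z -> pt g z -> degree x g0 -> g0 = g.
Proof.
move=> -> pz [z1 [/(@sf_in_inj _ (F t)) ez dz]]; rewrite -ez in dz.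
exact: LP_degree_pt pz dz.
Qed.

Let newvar_pt t k : exists2 z, mst (sf_in (FQ _) (mon Q (mu t k) (bas (uf k)))) = sf_in (FQ t) z
  & pt (mneg t k) z.
Proof.
have [|z ez [pz _]] := mm_mon_ge0 (mstP t k) (h := bas (uf k)); first by rewrite basE eqxx.
by exists z => //; rewrite mutE_bas mut_basE eqxx in pz.
Qed.

(** [gvector_phi] iterated along the word, which ties [phi_seq] to actual degrees. *)
Let phi_seq_pt t u r (f : FQ r -> FQ t) i g z : D t -> rte f ->
  f (sf_in (FQ r) (mon Q r (bas i))) = sf_in (FQ t) z -> pt g z ->
  exists2 z', mustar_seq_inv mustar u (f (sf_in (FQ r) (mon Q r (bas i)))) = sf_in (FQ _) z'
    & pt (phi_seq t u g) z'.
Proof.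
elim: u t f g z => [|k u IH] t f g z Dt rf ez pz; first by exists z.
have rf' := route_trans rf (route_mst_inv mstP mstK mst_invK t k).
have [g' [z' ez' pz']] := Dpt (Dmu k Dt) rf' i.
rewrite /= -(gvector_phi mstP mstK mst_invK Dmu Dpt Dt rf ez pz ez' pz').
exact: (IH _ _ _ _ (Dmu k Dt) rf' ez' pz').
Qed.

Let phi_back_pt t w r (f : FQ r -> FQ (mutseq t w)) i g z : D t -> rte f ->
  f (sf_in (FQ r) (mon Q r (bas i))) = sf_in (FQ _) z -> pt g z ->
  exists2 z', mustar_seq mustar (f (sf_in (FQ r) (mon Q r (bas i)))) = sf_in (FQ t) z'
    & pt (phi_back t w g) z'.
Proof.
elim: w t f z => [|k w IH] t f z Dt rf ez pz; first by exists z.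
have [z1 ez1 pz1] := IH (mu t k) f z (Dmu k Dt) rf ez pz.
have rf1 := route_trans rf (route_mustar_seq (mu t k) w).
have rf2 := route_trans rf1 (route_mst _ t k).
have [g2 [z2 ez2 pz2]] := Dpt Dt rf2 i; exists z2; first exact: ez2.
have eg := gvector_phi mstP mstK mst_invK Dmu Dpt Dt rf2 ez2 pz2
  (etrans (@mstK t k _) ez1) pz1.
suff -> : phi_back t (k :: w) g = g2 by [].
by rewrite /= eg (phi_invol _ (seed_adj_mu t k)).
Qed.

(** Needed because the word from [mu t k] to its shift begins by mutating back at [k]. *)
Let mustar_mu_mu t k w i :
  mustar t k (mustar (mu t k) k (mustar_seq mustar (Xvar F (mutseq (mu (mu t k) k) w) i)))
  = mustar_seq mustar (Xvar F (mutseq t w) i).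
Proof.
have H s : mu (mu t k) k = s -> forall h : FQ s -> FQ (mu t k), mutmap k h ->
    mustar (mu t k) k (mustar_seq mustar (Xvar F (mutseq (mu (mu t k) k) w) i))
    = h (mustar_seq mustar (Xvar F (mutseq s w) i)).
  by move=> e; case: s / e => h mh; apply: mutmap_uniq (mstP _ _) mh _.
have e := H t (mu_invol t k) (@mst_inv t k) (mutmap_mst_inv mstP mstK mst_invK t k).
exact: etrans (congr1 (mustar t k) e) (@mst_invK t k _).
Qed.

Let shift_of s t (th : FQ t -> FQ s) (sigma : {perm 'I_n}) : D s -> rte th ->
  (forall k, degree_uf_opp (F := F) (th (Xvar F t (uf (sigma k)))) k) ->
  forall k', exists g, exists2 z,
    th (sf_in (FQ t) (mon Q t (bas (uf (sigma k'))))) = sf_in (FQ s) z &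
    pt g z /\ forall j, g (uf j) 0 = - (j == k')%:R.
Proof.
move=> Ds rth H k'; have [g [z ez pz]] := Dpt Ds rth (uf (sigma k')).
have [g1 [dg1 eg1]] := H k'; exists g, z => //; split=> //.
by rewrite -(degree_pt ez pz dg1).
Qed.

Lemma pointed_power_to t k d u sigma : in_Delta t0 t -> is_unshift mustar t u sigma ->
  let A : F t := mustar t k (Xvar F (mu t k) (uf k)) in
  forall g0, degree A g0 -> forall Z : F t, pointed (g0 *+ d) Z ->
  compatibly_pointed_to mustar u Z -> Z = A ^+ d.
Proof.
move=> Dt Hsh A g0 dA Z pZ [_ _ [g1 [pg1 pZ']]].
have [a ea pa] := newvar_pt t k; have eg0 := degree_pt ea pa dA; subst g0.
have [z ez pz] := pointed_pt pZ.
rewrite (pointed_uniq pg1 pZ) phi_seq_mulrn in pZ'.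
have [w ew pw] := pointed_pt pZ'.
have Ds := in_Delta_mutseq u Dt; have rth := route_mustar_seq_inv t u.
have [zA eA pA] := phi_seq_pt u Dt (route_mst _ t k) ea pa.
have sh := shift_of Ds rth Hsh; have [G gm] := gmat_exists Dpt Ds rth.
have ew' := etrans (congr1 (mustar_seq_inv mustar u) (esym ez)) ew.
apply: (etrans ez).
(* Here [s] is [t[-1]], and the variable [k] of [t] has index [(sigma^-1)%g k] there. *)
have := shift_pointed_power mstP mstK mst_invK Dmu Dpt Ds rth sh gm (k' := (sigma^-1)%g k)
  (d := d) (z := z) (w := w) (zA := zA) (gA := phi_seq t u (mneg t k)).
by rewrite permKV; apply.
Qed.

(** The theorem on shifts is applied with [t] in the role of [s] and [t[1]] in the role of [t]; its
    conclusion, in the field of [t[1]], is carried back along [w]. *)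
Lemma pointed_power_from t k d w sigma : in_Delta t0 t -> is_shift mustar t w sigma ->
  let A : F t := mustar t k (Ivar mustar (mu t k) (k :: rcons w (sigma k)) sigma k) in
  forall g0, degree A g0 -> forall Z : F t, pointed (g0 *+ d) Z ->
  compatibly_pointed_from mustar w Z -> Z = A ^+ d.
Proof.
move=> Dt Hsh A g0 dA Z pZ [_ _ [g1 [pg1 pZ']]].
pose s := mutseq t w; pose A1 : F s := mustar s (sigma k) (Xvar F (mu s (sigma k)) (uf (sigma k))).
(* [A] is the new variable obtained by mutating [t[1]] at [sigma k], seen from [t]. *)
have eA1 : A = mustar_seq mustar A1.
  rewrite /A /Ivar /= mustar_mu_mu; have [e <-] := mustar_seq_rcons t w (sigma k).
  by congr (mustar_seq _ (mustar _ _ _)); case: _ / e.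
have [a ea pa] := newvar_pt s (sigma k); have Ds := in_Delta_mutseq w Dt.
have rth := route_mustar_seq t w.
have [zA eA pA] := phi_back_pt Dt (route_mst _ s (sigma k)) ea pa.
have eg0 : g0 = phi_back t w (mneg s (sigma k)) by apply: degree_pt pA dA; rewrite eA1.
have [z ez pz] := pointed_pt pZ; have [z2 ez2 pz2] := pointed_pt pg1.
(* The degree of [Z] is prescribed at [t]; injectivity of [phi_back] recovers it at [t[1]]. *)
have := pointed_uniq pZ' pZ; rewrite eg0 -phi_back_mulrn => /phi_back_inj eg1.
rewrite eg1 in pz2; rewrite eg0 in pz.
have sh := shift_of Dt rth Hsh; have [G gm] := gmat_exists Dpt Dt rth.
have ez3 : mustar_seq mustar (w := w) (sf_in (FQ _) z2) = sf_in (FQ t) z.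
  exact: etrans (congr1 _ (esym ez2)) (etrans (mustar_seqK w Z) ez).
have e := shift_pointed_power mstP mstK mst_invK Dmu Dpt Dt rth sh gm pz2 ez3 eA pA pz.
apply: (etrans ez); rewrite eA1 -[LHS]ez3 e.
exact: (homX (route_ishom mstP rth)).
Qed.

End Main.

Theorem proposition6p4p5 (n m : nat)
  (F : forall t : qseed n m, skew_field_of_fractions (LP t))
  (mustar : forall (t : qseed n m) (k : 'I_n), mutation_iso F t k)
  (t0 : qseed n m) (Hpointed : cluster_variables_pointed mustar t0)
  (t : qseed n m) (Ht : in_Delta t0 t) (Hir : injective_reachable mustar t)
  (k : 'I_n) (d : nat) :
  (forall (u : seq 'I_n) (sigma : {perm 'I_n}), is_unshift mustar t u sigma ->
     let A : F t := mustar t k (Xvar F (mu t k) (lshift m k)) in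
     forall g0 : 'cV[int]_(n + m), degree A g0 ->
     forall Z : F t, in_LP Z -> in_LP (mustar_seq_inv mustar u Z) ->
       pointed (g0 *+ d) Z ->
       compatibly_pointed_to mustar u Z ->
       Z = A ^+ d)
  /\
  (forall (w : seq 'I_n) (sigma : {perm 'I_n}), is_shift mustar t w sigma ->
     let A : F t := mustar t k
       (Ivar mustar (mu t k) (k :: rcons w (sigma k)) sigma k) in
     forall g0 : 'cV[int]_(n + m), degree A g0 ->
     forall Z : F t, in_LP Z -> in_LP (mustar_seq_inv mustar w Z) ->
       pointed (g0 *+ d) Z ->
       compatibly_pointed_from mustar w Z ->
       Z = A ^+ d).
Proof.
split=> [u sigma Hu A g0 dA Z _ _|w sigma Hw A g0 dA Z _ _].
  exact: (pointed_power_to Hpointed Ht Hu dA).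
exact: (pointed_power_from Hpointed Ht Hw dA).
Qed.
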